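(* Let $R$ be a commutative Noetherian ring, and let $\mathcal{A}\subseteq\mathcal{M}$ be resolving subcategories of $\mathrm{mod}(R)$ such that $\mathcal{A}$ cogenerates $\mathcal{M}$ and $\mathrm{add}\,\mathcal{A}_p$ is thick in $\mathrm{add}\,\mathcal{M}_p$ for all $p\in\mathrm{Spec}\,R$. Let $\Psi$ be a set of increasing functions from $\mathrm{Spec}\,R$ to $\mathbb{N}$. Define $\eta_{\mathcal{A}}^{\mathcal{M}}:\mathfrak{R}(\mathcal{A})\to\mathfrak{R}(\mathcal{M})$ by $\eta_{\mathcal{A}}^{\mathcal{M}}(\mathcal{X})=\mathrm{res}(\mathcal{X}\cup\mathcal{M})$ and $\rho_{\mathcal{A}}^{\mathcal{M}}:\mathfrak{R}(\mathcal{M})\to\mathfrak{R}(\mathcal{A})$ by $\rho_{\mathcal{A}}^{\mathcal{M}}(\mathcal{X})=\Delta(\mathcal{A})\cap\mathcal{X}$. If $\Phi_{\mathcal{A}}$ and $\Lambda_{\mathcal{A}}$ are inverses of each other giving a bijection between $\mathfrak{R}(\mathcal{A})$ and $\Psi$, then $\Phi_{\mathcal{M}}\circ\eta_{\mathcal{A}}^{\mathcal{M}}=\Phi_{\mathcal{A}}$ as maps $\mathfrak{R}(\mathcal{A})\to\Psi$, the map $\Phi_{\mathcal{M}}:\mathfrak{R}(\mathcal{M})\to\Psi$ is bijective with inverse $\Lambda_{\mathcal{M}}$, and $\rho_{\mathcal{A}}^{\mathcal{M}}$ is the inverse of $\eta_{\mathcal{A}}^{\mathcal{M}}$.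
   Context: All modules are finitely generated; $\mathrm{mod}(R)$ is the category of finitely generated $R$-modules; all subcategories are full and closed under isomorphism; $\mathbb{N}$ includes $0$. A function $f:\mathrm{Spec}\,R\to\mathbb{N}$ is increasing if $p\subseteq q$ implies $f(p)\le f(q)$. A subcategory $\mathcal{M}\subseteq\mathrm{mod}(R)$ is resolving if (1) $R\in\mathcal{M}$; (2) $M\oplus N\in\mathcal{M}$ if and only if $M,N\in\mathcal{M}$; (3) for any exact sequence $0\to M\to N\to L\to 0$ with $L\in\mathcal{M}$, $N\in\mathcal{M}$ if and only if $M\in\mathcal{M}$. $\mathrm{res}(\mathcal{X})$ is the smallest resolving subcategory containing $\mathcal{X}$. A resolving subcategory $\mathcal{M}\subseteq\mathcal{N}$ is thick in $\mathcal{N}$ if for any exact sequence $0\to L\to M\to N\to 0$ with $L,M\in\mathcal{M}$ and $N\in\mathcal{N}$ one has $N\in\mathcal{M}$. For $\mathcal{A}\subseteq\mathcal{M}$, $\mathcal{A}$ cogenerates $\mathcal{M}$ if for every $M\in\mathcal{M}$ there is an exact sequence $0\to M\to A\to M'\to 0$ with $A\in\mathcal{A}$, $M'\in\mathcal{M}$. $\mathcal{M}\text{-}\dim X$ is the smallest $n\in\mathbb{N}$ such that there is an exact sequence $0\to M_n\to\cdots\to M_0\to X\to 0$ with all $M_i\in\mathcal{M}$ ($\infty$ if none exists). $\Delta(\mathcal{M})=\{X\in\mathrm{mod}(R)\mid\mathcal{M}\text{-}\dim X<\infty\}$. $\mathfrak{R}(\mathcal{M})$ is the collection of resolving subcategories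 $\mathcal{X}$ with $\mathcal{M}\subseteq\mathcal{X}\subseteq\Delta(\mathcal{M})$. For $p\in\mathrm{Spec}\,R$, $\mathrm{add}\,\mathcal{M}_p$ is the smallest subcategory of $\mathrm{mod}(R_p)$ containing $M_p$ for every $M\in\mathcal{M}$ and closed under finite direct sums and direct summands. For a function $f:\mathrm{Spec}\,R\to\mathbb{N}$ and a subcategory $\mathcal{X}$, $$\Lambda_{\mathcal{M}}(f)=\{X\in\mathrm{mod}(R)\mid \mathrm{add}\,\mathcal{M}_p\text{-}\dim X_p\le f(p)\ \ \forall p\in\mathrm{Spec}\,R\},$$ $$\Phi_{\mathcal{M}}(\mathcal{X})(p)=\sup\{\mathrm{add}\,\mathcal{M}_p\text{-}\dim X_p\mid X\in\mathcal{X}\}.$$ *)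

(* Defs.v *)
From HB Require Import structures.
From mathcomp Require Import all_boot all_order all_algebra.
From mathcomp Require Import boolp ring.

Set Implicit Arguments.
Unset Strict Implicit.
Unset Printing Implicit Defensive.

Import GRing.Theory.

Local Open Scope ring_scope.
Local Open Scope quotient_scope.

(* Classes of objects. The library's [set] cannot be used for classes of
   modules: [set (lmodType R)] is a universe inconsistency. *)
Definition class (T : Type) := T -> Prop.

Definition sub_class (T : Type) (A B : class T) : Prop :=
  forall x, A x -> B x.

Definition smallest (T : Type) (P : class (class T)) (G : class T) : class T :=
  fun x => forall C : class T, P C -> sub_class G C -> C x.

Definition inverse_bijections (T U : Type) (A : class T) (B : class U)
    (f : T -> U) (g : U -> T) : Prop :=
  [/\ forall x, A x -> B (f x),
      forall y, B y -> A (g y),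
      forall x, A x -> g (f x) = x
    & forall y, B y -> f (g y) = y].

(* [None] is infinity. *)
Definition enat := option nat.

Definition enat_le (x y : enat) : bool :=
  match x, y with
  | _, None => true
  | None, Some _ => false
  | Some m, Some n => (m <= n)%N
  end.

(* The least element of [P], infinity if [P] is empty. *)
Definition enat_least (P : class nat) : enat :=
  match pselect (exists n, `[< P n >]) with
  | left exP => Some (ex_minn exP)
  | right _ => None
  end.

Definition enat_sup (S : class enat) : enat :=
  enat_least (fun n => forall x, S x -> enat_le x (Some n)).

Definition enat_fun (T : Type) (f : T -> nat) : T -> enat := fun t => Some (f t).

Definition enat_funs (T : Type) (Psi : class (T -> nat)) : class (T -> enat) :=
  fun g => exists2 f, Psi f & g = enat_fun f.

(* [R^o] is [R] as a module over itself, so its submodules are the ideals. *)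
Definition noetherian (R : comPzRingType) : Prop :=
  forall I : {pred R^o}, submod_closed I ->
    exists (n : nat) (v : 'I_n -> R),
      forall x : R, x \in I <-> exists c : 'I_n -> R, x = \sum_i c i * v i.

(* The library's [prime_idealr] is only available over nontrivial rings. *)
Record spec (R : comPzRingType) := Spec {
  prime_pred :> {pred R};
  prime_submod : submod_closed (prime_pred : {pred R^o});
  prime_proper : 1 \notin prime_pred;
  prime_mul : forall x y : R,
    x * y \in prime_pred -> (x \in prime_pred) || (y \in prime_pred)
}.

Definition increasing (R : comPzRingType) (f : spec R -> nat) : Prop :=
  forall p q : spec R, {subset p <= q} -> (f p <= f q)%N.

Section Modules.
Variable R : comPzRingType.

Definition fin_gen (M : lmodType R) : Prop :=
  exists (n : nat) (v : 'I_n -> M),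
    forall x : M, exists c : 'I_n -> R, x = \sum_i c i *: v i.

Definition isomorphic (M N : lmodType R) : Prop :=
  exists f : {linear M -> N}, bijective f.

Definition surjective (M N : lmodType R) (f : {linear M -> N}) : Prop :=
  forall y, exists x, f x = y.

Definition exact_at (L M N : lmodType R)
    (f : {linear L -> M}) (g : {linear M -> N}) : Prop :=
  forall y, g y = 0 <-> exists x, f x = y.

Definition short_exact (L M N : lmodType R)
    (f : {linear L -> M}) (g : {linear M -> N}) : Prop :=
  [/\ injective f, exact_at f g & surjective g].

(* A full subcategory of mod(R), closed under isomorphism, is given by the
   class of its objects. *)
Definition subcategory (C : class (lmodType R)) : Prop :=
  (forall M, C M -> fin_gen M) /\
  (forall M N, isomorphic M N -> C M -> C N).

Definition resolving (C : class (lmodType R)) : Prop :=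
  [/\ subcategory C,
      C R^o,
      forall M N : lmodType R, C (M * N)%type <-> C M /\ C N
    & forall (M N L : lmodType R) (f : {linear M -> N}) (g : {linear N -> L}),
        fin_gen M -> fin_gen N -> short_exact f g -> C L -> (C N <-> C M)].

Definition res (X : class (lmodType R)) : class (lmodType R) :=
  smallest resolving X.

Definition thick_in (C D : class (lmodType R)) : Prop :=
  [/\ resolving C,
      sub_class C D
    & forall (L M N : lmodType R) (f : {linear L -> M}) (g : {linear M -> N}),
        short_exact f g -> C L -> C M -> D N -> C N].

Definition cogenerates (A C : class (lmodType R)) : Prop :=
  sub_class A C /\
  forall M, C M ->
    exists (N M' : lmodType R) (f : {linear M -> N}) (g : {linear N -> M'}),
      [/\ short_exact f g, A N & C M'].

(* An exact sequence 0 -> M_n -> ... -> M_0 -> X -> 0, encoded as a sequence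
   indexed by all of nat with M_i = 0 for i > n. *)
Definition has_resolution (C : class (lmodType R)) (X : lmodType R) (n : nat)
    : Prop :=
  exists (M : nat -> lmodType R) (d : forall i, {linear M i.+1 -> M i})
         (e : {linear M 0%N -> X}),
    [/\ forall i, (i <= n)%N -> C (M i),
        forall i, (n < i)%N -> forall x : M i, x = 0,
        surjective e,
        exact_at (d 0%N) e
      & forall i, exact_at (d i.+1) (d i)].

Definition resdim (C : class (lmodType R)) (X : lmodType R) : enat :=
  enat_least (has_resolution C X).

Definition Delta (C : class (lmodType R)) : class (lmodType R) :=
  fun X => fin_gen X /\ resdim C X <> None.

(* The collection written \mathfrak{R}(C). *)
Definition resolvings (C : class (lmodType R)) : class (class (lmodType R)) :=
  fun X => [/\ resolving X, sub_class C X & sub_class X (Delta C)].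

(* The condition on zero modules is closure under the empty direct sum. *)
Definition add_closed (C : class (lmodType R)) : Prop :=
  [/\ subcategory C,
      forall M : lmodType R, (forall x : M, x = 0) -> C M,
      forall M N : lmodType R, C M -> C N -> C (M * N)%type
    & forall M N : lmodType R, C (M * N)%type -> C M].

Definition add_closure (X : class (lmodType R)) : class (lmodType R) :=
  smallest add_closed X.

End Modules.

Section Localization.
Variables (R : comPzRingType) (p : spec R).

Record denom := Denom { den : R; denP : den \notin p }.

HB.instance Definition _ := [isSub for den].
HB.instance Definition _ := [Choice of denom by <:].

Lemma denomM_subproof (s t : denom) : den s * den t \notin p.
Proof.
apply/negP => /prime_mul /orP[] H.
- by move: (denP s); rewrite H.
- by move: (denP t); rewrite H.
Qed.

Definition denom1 : denom := Denom (prime_proper p).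
Definition denomM (s t : denom) : denom :=
  Denom (denomM_subproof s t).

Section LocMod.
Variable M : lmodType R.

Definition loc_rel (u v : M * denom) : bool :=
  `[< exists t : denom, den t *: (den v.2 *: u.1) = den t *: (den u.2 *: v.1) >].

Lemma loc_rel_equiv : equiv_class_of loc_rel.
Proof.
split=> [u|u v|v u w].
- by apply/asboolP; exists denom1.
- by apply/asboolP/asboolP => -[t e]; exists t.
- move=> /asboolP[t e] /asboolP[t' e']; apply/asboolP.
  exists (denomM (denomM t t') v.2) => /=.
  rewrite !scalerA in e e' *.
  have -> : den t * den t' * den v.2 * den w.2 =
            den t' * den w.2 * (den t * den v.2) by ring.
  rewrite -scalerA e scalerA.
  have -> : den t' * den w.2 * (den t * den u.2) =
            den t * den u.2 * (den t' * den w.2) by ring.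
  by rewrite -scalerA e' scalerA; congr (_ *: _); ring.
Qed.

Canonical loc_equiv := EquivRelPack loc_rel_equiv.

Definition loc_mod : Type := {eq_quot loc_equiv}.
HB.instance Definition _ := Choice.copy loc_mod {eq_quot loc_equiv}.
HB.instance Definition _ := EqQuotient.copy loc_mod {eq_quot loc_equiv}.

Definition frac (m : M) (s : denom) : loc_mod := \pi_loc_mod (m, s).

Lemma frac_eq m s n t : frac m s = frac n t <->
  exists u : denom, den u *: (den t *: m) = den u *: (den s *: n).
Proof.
split=> [/eqmodP /asboolP //|H]; apply/eqmodP; exact/asboolP.
Qed.

Lemma fracP (x : loc_mod) : exists m s, x = frac m s.
Proof. by exists (repr x).1, (repr x).2; rewrite /frac -surjective_pairing reprK. Qed.

Definition loc_add (x y : loc_mod) : loc_mod :=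
  frac (den (repr y).2 *: (repr x).1 + den (repr x).2 *: (repr y).1)
       (denomM (repr x).2 (repr y).2).

Definition loc_opp (x : loc_mod) : loc_mod := frac (- (repr x).1) (repr x).2.

Lemma repr_frac m s : exists u : denom,
  den u *: (den s *: (repr (frac m s)).1) = den u *: (den (repr (frac m s)).2 *: m).
Proof.
by apply/frac_eq; rewrite /frac -surjective_pairing reprK.
Qed.

Lemma loc_addE m s n t :
  loc_add (frac m s) (frac n t) = frac (den t *: m + den s *: n) (denomM s t).
Proof.
have [u e] := repr_frac m s; have [v f] := repr_frac n t.
rewrite /loc_add; set x := repr (frac m s) in e *; set y := repr (frac n t) in f *.
apply/frac_eq; exists (denomM u v) => /=.
rewrite !scalerDr !scalerA in e f *; congr (_ + _).
- have -> : den u * den v * (den s * den t) * den y.2 =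
            den v * den t * den y.2 * (den u * den s) by ring.
  by rewrite -scalerA e scalerA; congr (_ *: _); ring.
- have -> : den u * den v * (den s * den t) * den x.2 =
            den u * den s * den x.2 * (den v * den t) by ring.
  by rewrite -scalerA f scalerA; congr (_ *: _); ring.
Qed.

Lemma loc_oppE m s : loc_opp (frac m s) = frac (- m) s.
Proof.
have [u e] := repr_frac m s; apply/frac_eq; exists u.
by rewrite !scalerN e.
Qed.

Lemma loc_addA : associative loc_add.
Proof.
move=> x y z; have [m [s ->]] := fracP x; have [n [t ->]] := fracP y.
have [k [w ->]] := fracP z; rewrite !loc_addE; apply/frac_eq; exists denom1 => /=.
rewrite !scale1r !scalerDr !scalerA addrA; congr (_ + _ + _); congr (_ *: _); ring.
Qed.

Lemma loc_addC : commutative loc_add.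
Proof.
move=> x y; have [m [s ->]] := fracP x; have [n [t ->]] := fracP y.
rewrite !loc_addE addrC; apply/frac_eq; exists denom1 => /=.
by rewrite [den t * _]mulrC.
Qed.

Lemma loc_add0 : left_id (frac 0 denom1) loc_add.
Proof.
move=> x; have [m [s ->]] := fracP x; rewrite loc_addE scaler0 add0r.
by apply/frac_eq; exists denom1 => /=; rewrite !scale1r mul1r.
Qed.

Lemma loc_addN : left_inverse (frac 0 denom1) loc_opp loc_add.
Proof.
move=> x; have [m [s ->]] := fracP x; rewrite loc_oppE loc_addE scalerN addNr.
by apply/frac_eq; exists denom1; rewrite !scaler0.
Qed.

HB.instance Definition _ :=
  GRing.isZmodule.Build loc_mod loc_addA loc_addC loc_add0 loc_addN.

Lemma frac_add m s n t :
  frac m s + frac n t = frac (den t *: m + den s *: n) (denomM s t).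
Proof. exact: loc_addE. Qed.

End LocMod.

(* R_p has the additive structure of the localization of the module R. *)
Definition loc_ring : Type := loc_mod R^o.
HB.instance Definition _ := GRing.Zmodule.copy loc_ring (loc_mod R^o).

Definition rfrac (a : R) (s : denom) : loc_ring := frac (a : R^o) s.

Lemma rfracP (x : loc_ring) : exists a s, x = rfrac a s.
Proof. exact: (@fracP R^o x). Qed.

Lemma rfrac_eq a s b t : rfrac a s = rfrac b t <->
  exists u : denom, den u * (den t * a) = den u * (den s * b).
Proof. exact: (@frac_eq R^o). Qed.

Lemma rfrac_add a s b t :
  rfrac a s + rfrac b t = rfrac (den t * a + den s * b) (denomM s t).
Proof. exact: (@frac_add R^o). Qed.

Definition loc_scale (M : lmodType R) (a : loc_ring) (x : loc_mod M) : loc_mod M :=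
  frac ((repr a).1 *: (repr x).1) (denomM (repr a).2 (repr x).2).

Lemma loc_scaleE (M : lmodType R) a s (m : M) t :
  loc_scale (rfrac a s) (frac m t) = frac (a *: m) (denomM s t).
Proof.
have [u e] : exists u : denom,
    den u * (den s * (repr (rfrac a s)).1) = den u * (den (repr (rfrac a s)).2 * a).
  exact: (@repr_frac R^o a s).
have [v f] := repr_frac m t.
rewrite /loc_scale.
set x := repr (rfrac a s) in e *; set y := repr (frac m t) in f *.
apply/frac_eq; exists (denomM u v) => /=; rewrite !scalerA in f *.
have -> : den u * den v * (den s * den t) * x.1 =
          den u * (den s * x.1) * (den v * den t) by ring.
have -> : den u * den v * (den x.2 * den y.2) * a =
          den u * (den x.2 * a) * (den v * den y.2) by ring.
by rewrite -scalerA f scalerA e.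
Qed.

Definition loc_mul (x y : loc_ring) : loc_ring := @loc_scale R^o x y.

Lemma loc_mulE a s b t : loc_mul (rfrac a s) (rfrac b t) = rfrac (a * b) (denomM s t).
Proof. exact: loc_scaleE. Qed.

Lemma loc_mulA : associative loc_mul.
Proof.
move=> x y z; have [a [s ->]] := rfracP x; have [b [t ->]] := rfracP y.
have [c [w ->]] := rfracP z; rewrite !loc_mulE; apply/rfrac_eq.
by exists denom1 => /=; ring.
Qed.

Lemma loc_mulC : commutative loc_mul.
Proof.
move=> x y; have [a [s ->]] := rfracP x; have [b [t ->]] := rfracP y.
by rewrite !loc_mulE; apply/rfrac_eq; exists denom1 => /=; ring.
Qed.

Lemma loc_mul1 : left_id (rfrac 1 denom1) loc_mul.
Proof.
move=> x; have [a [s ->]] := rfracP x; rewrite loc_mulE.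
by apply/rfrac_eq; exists denom1 => /=; ring.
Qed.

Lemma loc_mulD : left_distributive loc_mul +%R.
Proof.
move=> x y z; have [a [s ->]] := rfracP x; have [b [t ->]] := rfracP y.
have [c [w ->]] := rfracP z; rewrite rfrac_add !loc_mulE rfrac_add.
by apply/rfrac_eq; exists denom1 => /=; ring.
Qed.

HB.instance Definition _ :=
  GRing.Zmodule_isComPzRing.Build loc_ring loc_mulA loc_mulC loc_mul1 loc_mulD.

Lemma rfrac_mul a s b t : rfrac a s * rfrac b t = rfrac (a * b) (denomM s t).
Proof. exact: loc_mulE. Qed.

Section LocLmodule.
Variable M : lmodType R.

Lemma loc_scaleA (a b : loc_ring) (x : loc_mod M) :
  loc_scale a (loc_scale b x) = loc_scale (a * b) x.
Proof.
have [c [s ->]] := rfracP a; have [d [t ->]] := rfracP b; have [m [w ->]] := fracP x.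
rewrite rfrac_mul !loc_scaleE scalerA.
by apply/frac_eq; exists denom1 => /=; rewrite mulrA.
Qed.

Lemma loc_scale1 : left_id (1 : loc_ring) (@loc_scale M).
Proof.
move=> x; have [m [w ->]] := fracP x; rewrite loc_scaleE scale1r.
by apply/frac_eq; exists denom1 => /=; rewrite mul1r.
Qed.

Lemma loc_scaleDr : right_distributive (@loc_scale M) +%R.
Proof.
move=> a x y; have [c [s ->]] := rfracP a; have [m [t ->]] := fracP x.
have [n [w ->]] := fracP y; rewrite frac_add !loc_scaleE frac_add.
apply/frac_eq; exists denom1 => /=.
by rewrite !scale1r !scalerDr !scalerA; congr (_ *: _ + _ *: _); ring.
Qed.

Lemma loc_scaleDl (x : loc_mod M) : {morph (@loc_scale M)^~ x : a b / a + b}.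
Proof.
move=> a b; have [c [s ->]] := rfracP a; have [d [t ->]] := rfracP b.
have [m [w ->]] := fracP x; rewrite rfrac_add !loc_scaleE frac_add.
apply/frac_eq; exists denom1 => /=.
rewrite !scale1r !scalerDl !scalerDr !scalerA.
by congr (_ *: _ + _ *: _); ring.
Qed.

HB.instance Definition _ :=
  GRing.Zmodule_isLmodule.Build loc_ring (loc_mod M)
    loc_scaleA loc_scale1 loc_scaleDr loc_scaleDl.

Lemma frac_scale a s (m : M) t :
  rfrac a s *: frac m t = frac (a *: m) (denomM s t).
Proof. exact: loc_scaleE. Qed.

End LocLmodule.

(* The subcategory add M_p of mod(R_p). *)
Definition add_loc (C : class (lmodType R)) : class (lmodType loc_ring) :=
  add_closure (fun Y => exists2 M, C M & Y = loc_mod M).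

End Localization.

Arguments loc_mod {R} p M.
Arguments add_loc {R} p C.

Section Maps.
Variable R : comPzRingType.

(* Lambda is defined on all enat-valued functions; on a nat-valued f it is
   applied to [enat_fun f]. *)
Definition Lambda (M : class (lmodType R)) (f : spec R -> enat)
    : class (lmodType R) :=
  fun X => fin_gen X /\
    forall p : spec R, enat_le (resdim (add_loc p M) (loc_mod p X)) (f p).

Definition Phi (M X : class (lmodType R)) (p : spec R) : enat :=
  enat_sup (fun n => exists2 Y, X Y & n = resdim (add_loc p M) (loc_mod p Y)).

Definition eta (M X : class (lmodType R)) : class (lmodType R) :=
  res (fun Y => X Y \/ M Y).

Definition rho (A X : class (lmodType R)) : class (lmodType R) :=
  fun Y => Delta A Y /\ X Y.

End Maps.

(* Main.v *)
From HB Require Import structures.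
From mathcomp Require Import all_boot all_order all_algebra.
From mathcomp Require Import boolp classical_sets ring.
Require Import Defs.

Set Implicit Arguments.
Unset Strict Implicit.
Unset Printing Implicit Defensive.

Import GRing.Theory.

Local Open Scope ring_scope.
Local Open Scope quotient_scope.

(** Three facts carry the argument.

    First, dimensions relative to a resolving class are independent of the
    presentation, so that the modules of dimension at most [n] again form a
    resolving class ([dim_le_resolving]).  If [C] is thick in [D], a module of
    finite [C]-dimension therefore has the same dimension over [C] and over [D]
    ([thick_dim_le]); applied at each prime, this says that [Lambda A f] is the
    intersection of [Delta A] with [Lambda M f] ([Lambda_Delta_cap]).

    Secondly, cogeneration yields Auslander-Buchweitz approximations: every [X]
    of finite [M]-dimension sits in an exact sequence 0 -> X -> N -> Y -> 0 with
    [N] of finite [A]-dimension and [Y] in [M] ([cogenerated_approximation]).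
    Hence a resolving class between [M] and [Delta M] is generated by [M] and
    its part in [Delta A], that is, [eta] after [rho] is the identity
    ([eta_rho]).

    Thirdly, [Lambda M f] is a resolving class between [M] and [Delta M] for
    every natural-valued [f] ([Lambda_resolvings]).  It is resolving because
    add M_p is; it lies in [Delta M] because the scalars [r] for which
    multiplication by [r] on some syzygy of [X] factors through a module of [M]
    form an ideal which no prime contains, hence contain 1
    ([local_finite_dim]).

    Given X between [A] and [Delta A] with [Phi A X = f], the generators of
    [eta M X] lie in [Lambda M f], so [eta M X] does too.  Intersecting with
    [Delta A] gives [rho A (eta M X)] inside [Lambda A f = X], and comparing
    dimensions gives [Phi M (eta M X) = f].  Thus [eta] and [rho] are mutually
    inverse, [Lambda M f = eta M (Lambda A f)], and the bijection given by
    [Phi A] and [Lambda A] is transported to [Phi M] and [Lambda M]. *)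

(** * Exact sequences of modules *)

Section LinearMaps.
Variable R : comPzRingType.
Implicit Types A D E F K L M N P Q T X Y Z : lmodType R.

Definition mklin M N (f : M -> N) (lf : linear f) : {linear M -> N} :=
  HB.pack f (GRing.isLinear.Build R M N *:%R f lf).

Lemma linear_injective M N (f : {linear M -> N}) :
  (forall x, f x = 0 -> x = 0) -> injective f.
Proof.
by move=> f0 x y fxy; apply/subr0_eq/f0; rewrite linearB /= fxy subrr.
Qed.

Lemma inj_surj_isomorphic M N (f : {linear M -> N}) :
  injective f -> surjective f -> isomorphic M N.
Proof.
move=> inj surj; exists f.
exists (fun y => projT1 (cid (surj y))) => [x|y].
  by apply: inj; case: cid.
by case: cid.
Qed.

Lemma bijective_inj_surj M N (f : {linear M -> N}) :
  bijective f -> injective f /\ surjective f.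
Proof.
move=> bf; split; first exact: bij_inj.
by case: bf => g _ gK y; exists (g y).
Qed.

Lemma isomorphic_sym M N : isomorphic M N -> isomorphic N M.
Proof.
case=> f [g fK gK].
have lg : linear g by move=> a x y; apply: (can_inj fK); rewrite linearP !gK.
by exists (mklin lg); exists f.
Qed.

(** The pointwise choice of preimages is linear because they are unique. *)
Lemma factor_inj K M X (i : {linear K -> M}) (h : {linear X -> M}) :
  injective i -> (forall x, exists k, i k = h x) ->
  exists h' : {linear X -> K}, forall x, i (h' x) = h x.
Proof.
move=> inj im; pose u x := projT1 (cid (im x)).
have uE x : i (u x) = h x by rewrite /u; case: cid.
have lu : linear u by move=> a x y; apply: inj; rewrite linearP !uE linearP.
by exists (mklin lu).
Qed.

(** Preimages under [q] are chosen arbitrarily; the choice is invisible to [h]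
    because [h] vanishes on the kernel of [q]. *)
Lemma factor_surj F X Y (q : {linear F -> X}) (h : {linear F -> Y}) :
  surjective q -> (forall x, q x = 0 -> h x = 0) ->
  exists h' : {linear X -> Y}, forall x, h' (q x) = h x.
Proof.
move=> surj ker; pose u x := projT1 (cid (surj x)).
have uE x : q (u x) = x by rewrite /u; case: cid.
have keq x y : q x = q y -> h x = h y.
  by move=> e; apply/subr0_eq; rewrite -linearB; apply: ker; rewrite linearB e subrr.
have lu : linear (h \o u).
  by move=> a x y /=; rewrite -linearP; apply: keq; rewrite linearP !uE.
by exists (mklin lu) => x /=; apply: keq; rewrite uE.
Qed.

Lemma short_exact_comp0 L M N (f : {linear L -> M}) (g : {linear M -> N}) x :
  exact_at f g -> g (f x) = 0.
Proof. by move=> ex; apply/ex; exists x. Qed.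

End LinearMaps.

Section Kernel.
Variables (R : comPzRingType) (M N : lmodType R) (g : {linear M -> N}).

Definition ker_pred : {pred M} := fun x => g x == 0.

Lemma ker_submod_closed : submod_closed ker_pred.
Proof.
split=> [|a x y]; first by rewrite unfold_in linear0.
by rewrite !unfold_in linearP => /eqP-> /eqP->; rewrite scaler0 addr0.
Qed.

HB.instance Definition _ :=
  GRing.isSubmodClosed.Build R M ker_pred ker_submod_closed.

Record kermod := Kermod { kerval : M; kermodP : kerval \in ker_pred }.

HB.instance Definition _ := [isSub for kerval].
HB.instance Definition _ := [Choice of kermod by <:].
HB.instance Definition _ := [SubChoice_isSubLmodule of kermod by <:].

Lemma kerval_linear : linear kerval.
Proof. by move=> a x y; exact: (linearP (val : {linear kermod -> M})). Qed.

(** Kernels and cokernels are used only through existence statements, so that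
    their carriers stay abstract and simplification cannot unfold them. *)
Lemma kernel_exists : exists (K : lmodType R) (k : {linear K -> M}),
  injective k /\ exact_at k g.
Proof.
exists kermod, (mklin kerval_linear); split; first exact: val_inj.
move=> y; split=> [gy|[[x xP] <-]]; last by apply/eqP.
have yP : y \in ker_pred by apply/eqP.
by exists (Kermod yP).
Qed.

End Kernel.

Section Cokernel.
Variables (R : comPzRingType) (L M : lmodType R) (f : {linear L -> M}).

Definition im_pred : {pred M} := fun y => `[< exists x, f x = y >].

Lemma im_submod_closed : submod_closed im_pred.
Proof.
split=> [|a x y]; first by apply/asboolP; exists 0; rewrite linear0.
move=> /asboolP[u <-] /asboolP[v <-]; apply/asboolP.
by exists (a *: u + v); rewrite linearP.
Qed.

HB.instance Definition _ :=
  GRing.isSubmodClosed.Build R M im_pred im_submod_closed.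

Definition cokmod : Type := Quotient.quot im_pred.
HB.instance Definition _ := GRing.Zmodule.on cokmod.
HB.instance Definition _ := EqQuotient.on cokmod.

Definition cokproj (x : M) : cokmod := \pi_cokmod x.

Lemma cokproj_eq x y : cokproj x = cokproj y <-> exists z, f z = x - y.
Proof.
have -> : (exists z, f z = x - y) <-> x - y \in im_pred.
  by split=> [H|/asboolP //]; apply/asboolP.
by rewrite Quotient.idealrBE; split=> /eqP.
Qed.

Lemma cokprojD : {morph cokproj : x y / x + y}.
Proof. by move=> x y; exact: Quotient.pi_add. Qed.

Lemma cokproj_surj y : exists x, cokproj x = y.
Proof. by exists (repr y); exact: reprK. Qed.

Definition cok_scale (a : R) (y : cokmod) : cokmod := cokproj (a *: repr y).

Lemma cok_scaleE a x : cok_scale a (cokproj x) = cokproj (a *: x).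
Proof.
rewrite /cok_scale; apply/cokproj_eq.
have /cokproj_eq[z e] : cokproj (repr (cokproj x)) = cokproj x by exact: reprK.
by exists (a *: z); rewrite linearZ /= e scalerBr.
Qed.

Lemma cok_scaleA a b y : cok_scale a (cok_scale b y) = cok_scale (a * b) y.
Proof. by case: (cokproj_surj y) => x <-; rewrite !cok_scaleE scalerA. Qed.

Lemma cok_scale1 : left_id 1 cok_scale.
Proof. by move=> y; case: (cokproj_surj y) => x <-; rewrite cok_scaleE scale1r. Qed.

Lemma cok_scaleDr : right_distributive cok_scale +%R.
Proof.
move=> a y z; case: (cokproj_surj y) (cokproj_surj z) => u <- [v <-].
by rewrite -cokprojD !cok_scaleE scalerDr cokprojD.
Qed.

Lemma cok_scaleDl y : {morph cok_scale^~ y : a b / a + b}.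
Proof.
by move=> a b; case: (cokproj_surj y) => x <-; rewrite !cok_scaleE scalerDl cokprojD.
Qed.

HB.instance Definition _ := GRing.Zmodule_isLmodule.Build R cokmod
  cok_scaleA cok_scale1 cok_scaleDr cok_scaleDl.

Lemma cokproj_linear : linear cokproj.
Proof. by move=> a x y; rewrite cokprojD; congr (_ + _); rewrite -cok_scaleE. Qed.

Lemma cokernel_exists : exists (Q : lmodType R) (q : {linear M -> Q}),
  exact_at f q /\ surjective q.
Proof.
exists cokmod, (mklin cokproj_linear); split; last exact: cokproj_surj.
move=> y; rewrite -(linear0 (mklin cokproj_linear)) /=; split.
  by case/cokproj_eq => x; rewrite subr0 => e; exists x.
by case=> x e; apply/cokproj_eq; exists x; rewrite subr0.
Qed.

End Cokernel.

Section Diagrams.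
Variable R : comPzRingType.
Implicit Types A D E F K L M N P Q T X Y Z : lmodType R.

Lemma inl_linear M N : linear (fun x : M => (x, 0) : M * N).
Proof. by move=> a x y /=; congr (_, _); rewrite /= scaler0 addr0. Qed.

Lemma inr_linear M N : linear (fun x : N => (0, x) : M * N).
Proof. by move=> a x y /=; congr (_, _); rewrite /= scaler0 addr0. Qed.

Definition inl_lin M N : {linear M -> (M * N)%type} := mklin (@inl_linear M N).
Definition inr_lin M N : {linear N -> (M * N)%type} := mklin (@inr_linear M N).

Lemma kernel_short_exact P X (f : {linear P -> X}) : surjective f ->
  exists (K : lmodType R) (k : {linear K -> P}), short_exact k f.
Proof. by move=> sf; have [K [k [jk exk]]] := kernel_exists f; exists K, k. Qed.

Lemma cokernel_short_exact L M (f : {linear L -> M}) : injective f ->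
  exists (Q : lmodType R) (q : {linear M -> Q}), short_exact f q.
Proof. by move=> jf; have [Q [q [exq sq]]] := cokernel_exists f; exists Q, q. Qed.

(** [T] is the fibre product of [P] and [P'] over [X]: each projection of [T] is
    surjective, with the kernel of the opposite map. *)
Lemma pullback_sequences K P X (K' P' : lmodType R)
    (i : {linear K -> P}) (f : {linear P -> X})
    (i' : {linear K' -> P'}) (f' : {linear P' -> X}) :
  short_exact i f -> short_exact i' f' ->
  exists (T : lmodType R) (a : {linear K -> T}) (b : {linear T -> P'})
    (a' : {linear K' -> T}) (b' : {linear T -> P}),
    short_exact a b /\ short_exact a' b'.
Proof.
move=> [ji exi sf] [ji' exi' sf'].
pose d : {linear (P * P')%type -> X} := (f \o fst) \- (f' \o snd).
have [T [j [jj exj]]] := kernel_exists d.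
have jk t : f (j t).1 = f' (j t).2.
  by apply/subr0_eq; exact: (short_exact_comp0 t exj).
have imj u v : f u = f' v -> exists t, j t = (u, v).
  by move=> e; apply/exj; rewrite /d /= e subrr.
have [|a aE] := @factor_inj R _ _ _ j (inl_lin P P' \o i) jj.
  by move=> k; apply: imj; rewrite linear0 (short_exact_comp0 k exi).
have [|a' aE'] := @factor_inj R _ _ _ j (inr_lin P P' \o i') jj.
  by move=> k; apply: imj; rewrite linear0 (short_exact_comp0 k exi').
exists T, a, (snd \o j), a', (fst \o j); split.
- split.
  + by move=> x y e; apply: ji; have := congr1 j e; rewrite !aE /= => -[].
  + move=> t /=; split=> [e|[k <-]]; last by rewrite aE.
    have /exi[k ke] : f (j t).1 = 0 by rewrite jk e linear0.
    by exists k; apply: jj; rewrite aE /= ke -e -surjective_pairing.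
  + move=> y; have [x e] := sf (f' y); have [t te] := imj _ _ e.
    by exists t; rewrite /= te.
- split.
  + by move=> x y e; apply: ji'; have := congr1 j e; rewrite !aE' /= => -[].
  + move=> t /=; split=> [e|[k <-]]; last by rewrite aE'.
    have /exi'[k ke] : f' (j t).2 = 0 by rewrite -jk e linear0.
    by exists k; apply: jj; rewrite aE' /= ke -e -surjective_pairing.
  + move=> y; have [x e] := sf' (f y); have [t te] := imj _ _ (esym e).
    by exists t; rewrite /= te.
Qed.

(** [E] is the pushout of [i] and [j], the quotient of [P * D] by the image of
    [K] under (i, -j).  Injectivity of [i] alone makes [D] embed in [E] with
    cokernel [X].  The kernel of [q] is part of the conclusion because
    identifying the localization of [E] requires it. *)
Lemma pushout_exists K P X D (i : {linear K -> P}) (f : {linear P -> X})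
    (j : {linear K -> D}) :
  short_exact i f ->
  exists (E : lmodType R) (q : {linear (P * D)%type -> E}) (e : {linear E -> X}),
    [/\ surjective q,
        forall x y, q (x, y) = 0 <-> exists k, x = i k /\ y = - j k
      & short_exact (q \o inr_lin P D : {linear D -> E}) e].
Proof.
move=> [ji exi sf].
have ld : linear (fun k : K => (i k, - j k) : P * D).
  by move=> a x y /=; rewrite !linearP.
have [E [q [exq sq]]] := cokernel_exists (mklin ld).
have qk x y : q (x, y) = 0 <-> exists k, x = i k /\ y = - j k.
  split=> [/exq[k [<- <-]]|[k [-> ->]]]; first by exists k.
  by apply/exq; exists k.
have [|e eE] := @factor_surj R _ _ _ q (f \o fst) sq.
  by case=> x y /qk[k [-> _]] /=; rewrite (short_exact_comp0 k exi).
exists E, q, e; split=> //; split.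
- apply: linear_injective => x /qk[k [/eqP + ->]].
  by rewrite eq_sym -(linear0 i) => /eqP/ji->; rewrite linear0 oppr0.
- move=> t; have [[x y] <-] := sq t; rewrite eE /=; split=> [/exi[k ke]|[z ze]].
    exists (y + j k); apply/subr0_eq; rewrite -linearB; apply/qk.
    exists (- k); split=> /=; first by rewrite sub0r linearN ke.
    by rewrite linearN opprK addrC addKr.
  have /qk[k [/eqP + _]] : q ((x, y) - (0, z)) = 0 by rewrite linearB /= -ze subrr.
  by rewrite /= subr0 => /eqP->; rewrite (short_exact_comp0 k exi).
- by move=> n; have [y <-] := sf n; exists (q (y, 0)); rewrite eE.
Qed.

Lemma pushout_sequences K P X D N
    (i : {linear K -> P}) (f : {linear P -> X})
    (j : {linear K -> D}) (g : {linear D -> N}) :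
  short_exact i f -> short_exact j g ->
  exists (E : lmodType R) (a : {linear P -> E}) (b : {linear E -> N})
    (c : {linear D -> E}) (e : {linear E -> X}),
    short_exact a b /\ short_exact c e.
Proof.
move=> sei [jj exj sg]; have [E [q [e [sq qk se]]]] := pushout_exists j sei.
have [|b bE] := @factor_surj R _ _ _ q (g \o snd) sq.
  by case=> x y /qk[k [_ ->]] /=; rewrite linearN (short_exact_comp0 k exj) oppr0.
exists E, (q \o inl_lin P D), b, (q \o inr_lin P D), e; split=> //; split.
- apply: linear_injective => x /qk[k [-> /eqP]].
  by rewrite eq_sym oppr_eq0 -(linear0 j) => /eqP/jj->; rewrite linear0.
- move=> t; have [[x y] <-] := sq t; rewrite bE /=; split=> [/exj[k ke]|[z ze]].
    exists (x + i k); apply/subr0_eq; rewrite -linearB; apply/qk.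
    by exists k; split=> /=; [rewrite addrC addKr|rewrite sub0r ke].
  have /qk[k [_ /eqP]] : q ((x, y) - (z, 0)) = 0 by rewrite linearB /= -ze subrr.
  by rewrite /= subr0 => /eqP->; rewrite linearN (short_exact_comp0 k exj) oppr0.
- by move=> n; have [y <-] := sg n; exists (q (0, y)); rewrite bE.
Qed.

(** A surjection onto the middle term of a short exact sequence links its own
    kernel, the kernel of the composite, and the left term: this is what is left
    of the horseshoe lemma when one presentation serves for both [Y] and [Z]. *)
Lemma kernel_of_composite X Y Z P (u : {linear X -> Y}) (v : {linear Y -> Z})
    (g : {linear P -> Y}) :
  short_exact u v -> surjective g ->
  exists (K L : lmodType R) (k : {linear K -> P}) (l : {linear L -> P})
    (a : {linear K -> L}) (b : {linear L -> X}),
    [/\ short_exact k g, short_exact l (v \o g : {linear P -> Z})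
      & short_exact a b].
Proof.
move=> [ju exu sv] sg.
have [K [k [jk exk]]] := kernel_exists g.
have [L [l [jl exl]]] := kernel_exists (v \o g).
have [|a aE] := @factor_inj R _ _ _ l k jl.
  by move=> x; apply/exl; rewrite /= (short_exact_comp0 x exk) linear0.
have [|b bE] := @factor_inj R _ _ _ u (g \o l) ju.
  by move=> x; apply/exu; exact: (short_exact_comp0 x exl).
exists K, L, k, l, a, b; split=> //.
  by split=> // z; have [y <-] := sv z; have [x <-] := sg y; exists x.
split.
- by move=> x y e; apply: jk; rewrite -!aE e.
- move=> t; split=> [t0|[x <-]].
    have /exk[x xe] : g (l t) = 0 by have /= := bE t; rewrite t0 linear0.
    by exists x; apply: jl; rewrite aE.
  by apply: ju; rewrite bE linear0 /= aE (short_exact_comp0 x exk).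
- move=> x; have [p pe] := sg (u x).
  have /exl[t te] : (v \o g) p = 0 by rewrite /= pe (short_exact_comp0 x exu).
  by exists t; apply: ju; rewrite bE /= te.
Qed.

(** The third isomorphism theorem for submodules D <= E <= A. *)
Lemma cokernel_of_composite D E X A N (c : {linear D -> E}) (e : {linear E -> X})
    (u : {linear E -> A}) (v : {linear A -> N}) :
  short_exact c e -> short_exact u v ->
  exists (Q : lmodType R) (q : {linear A -> Q})
     (a : {linear X -> Q}) (b : {linear Q -> N}),
     short_exact (u \o c : {linear D -> A}) q /\ short_exact a b.
Proof.
move=> [jc exc se] [ju exu sv].
have [Q [q [qk sq]]] := cokernel_exists (u \o c).
have [|a aE] := @factor_surj R _ _ _ e (q \o u) se.
  by move=> x /exc[d <-] /=; apply/qk; exists d.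
have [|b bE] := @factor_surj R _ _ _ q v sq.
  by move=> x /qk[d <-]; apply/exu; exists (c d).
exists Q, q, a, b; split.
  by split=> // x y /ju/jc.
split.
- apply: linear_injective => x; have [t <-] := se x; rewrite aE => /qk[d /ju <-].
  exact: (short_exact_comp0 d exc).
- move=> t; have [y <-] := sq t; rewrite bE; split=> [/exu[z <-]|[x]].
    by exists (e z); rewrite aE.
  have [z <-] := se x; rewrite aE /= => /eqP; rewrite eq_sym -subr_eq0 -linearB.
  move=> /eqP/qk[d] /= /eqP; rewrite eq_sym subr_eq => /eqP->.
  by rewrite linearD !(short_exact_comp0 _ exu) addr0.
- by move=> n; have [y <-] := sv n; exists (q y); rewrite bE.
Qed.

End Diagrams.

(** * Finitely generated modules over Noetherian rings *)

Section FinGen.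
Variable R : comPzRingType.
Implicit Types A D E F K L M N P Q T X Y Z : lmodType R.

Lemma rowcomb_linear X n (v : 'I_n -> X) :
  linear (fun c : 'rV[R]_n => \sum_i c 0 i *: v i).
Proof.
move=> a x y /=; rewrite scaler_sumr -big_split /=; apply: eq_bigr => i _.
by rewrite !mxE scalerDl scalerA.
Qed.

Definition rowcomb X n (v : 'I_n -> X) : {linear 'rV[R]_n -> X} :=
  mklin (rowcomb_linear v).

Lemma rowcomb_delta X n (v : 'I_n -> X) i : rowcomb v (delta_mx 0 i) = v i.
Proof.
rewrite /= (bigD1 i) //= big1 => [|j ne]; rewrite mxE ?eqxx ?scale1r ?addr0 //=.
by rewrite (negPf ne) scale0r.
Qed.

Lemma linear_rowE X n (h : {linear 'rV[R]_n -> X}) (c : 'rV[R]_n) :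
  h c = \sum_i c 0 i *: h (delta_mx 0 i).
Proof.
by rewrite {1}[c]row_sum_delta linear_sum; apply: eq_bigr => i _; rewrite linearZ.
Qed.

Lemma fin_gen_cover X : fin_gen X <->
  exists n (f : {linear 'rV[R]_n -> X}), surjective f.
Proof.
split=> [[n [v vP]]|[n [f sf]]].
  exists n, (rowcomb v) => x; have [c ->] := vP x; exists (\row_i c i) => /=.
  by apply: eq_bigr => i _; rewrite mxE.
exists n, (fun i => f (delta_mx 0 i)) => x; have [y <-] := sf x.
by exists (fun i => y 0 i); exact: linear_rowE.
Qed.

Lemma fin_gen_surj X Y (f : {linear X -> Y}) :
  surjective f -> fin_gen X -> fin_gen Y.
Proof.
move=> sf /fin_gen_cover[n [g sg]]; apply/fin_gen_cover; exists n, (f \o g) => y.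
by have [x <-] := sf y; have [z <-] := sg x; exists z.
Qed.

Lemma fin_gen_iso X Y : isomorphic X Y -> fin_gen X -> fin_gen Y.
Proof. by case=> f /bijective_inj_surj[_ sf]; exact: fin_gen_surj. Qed.

Lemma fin_gen_row n : fin_gen 'rV[R]_n.
Proof. by apply/fin_gen_cover; exists n, idfun => x; exists x. Qed.

Lemma fin_gen_extension K X Q (i : {linear K -> X}) (q : {linear X -> Q}) :
  short_exact i q -> fin_gen K -> fin_gen Q -> fin_gen X.
Proof.
move=> [_ ex sq] /fin_gen_cover[n [f sf]] [m [w wP]].
have [v vE] : exists v : 'I_m -> X, forall j, q (v j) = w j.
  by exists (fun j => projT1 (cid (sq (w j)))) => j; case: cid.
apply/fin_gen_cover; exists (n + m)%N.
pose l : {linear 'rV[R]_(n + m) -> 'rV[R]_n} := lsubmx.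
pose r : {linear 'rV[R]_(n + m) -> 'rV[R]_m} := rsubmx.
exists ((i \o (f \o l)) \+ (rowcomb v \o r)) => x.
have [c cE] := wP (q x).
have /ex[k ke] : q (x - rowcomb v (\row_j c j)) = 0.
  rewrite linearB /= linear_sum cE -sumrB big1 // => j _.
  by rewrite linearZ /= vE mxE subrr.
have [y ye] := sf k; exists (row_mx y (\row_j c j)).
by rewrite /l /r /= row_mxKl row_mxKr ye ke subrK.
Qed.

Lemma short_exact_prod X Y : short_exact (inl_lin X Y) (snd : {linear (X * Y)%type -> Y}).
Proof.
split=> [x y []//|[x y]|y]; last by exists (0, y).
by split=> [/= ->|[z [_ <-]]//]; exists x.
Qed.

Lemma fin_gen_prod X Y : fin_gen X -> fin_gen Y -> fin_gen (X * Y)%type.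
Proof. exact: fin_gen_extension (short_exact_prod X Y). Qed.

Lemma row_prod_isomorphic n : isomorphic (R^o * 'rV[R]_n)%type 'rV[R]_n.+1.
Proof.
have lf : linear (fun x : R^o * 'rV[R]_n => row_mx (x.1)%:M x.2 : 'rV[R]_(1 + n)).
  move=> a [x u] [y v] /=; rewrite scale_row_mx add_row_mx; congr row_mx.
  by rewrite scale_scalar_mx -raddfD.
exists (mklin lf); exists (fun w : 'rV[R]_(1 + n) => (lsubmx w 0 0 : R^o, rsubmx w)).
  by move=> [x u] /=; rewrite row_mxKl row_mxKr mxE eqxx mulr1n.
move=> w /=; rewrite -[RHS](@hsubmxK _ _ 1 n); congr row_mx.
by apply/matrixP => i j; rewrite !ord1 !mxE eqxx mulr1n.
Qed.

(** Submodules are given as injections, the form in which kernels arise. *)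
Definition noetherian_mod X : Prop :=
  forall K (k : {linear K -> X}), injective k -> fin_gen K.

Lemma noetherian_mod_ring : noetherian R -> noetherian_mod (R^o).
Proof.
move=> noeth K k jk.
have [n [v vP]] := noeth _ (@im_submod_closed R K R^o k).
have [w wE] : exists w : 'I_n -> K, forall i, k (w i) = v i.
  suff H i : exists x, k x = v i by exists (fun i => projT1 (cid (H i))) => i; case: cid.
  suff : (v i : R^o) \in im_pred k by move/asboolP.
  apply/vP; exists (fun j => (j == i)%:R); rewrite (bigD1 i) //= eqxx mul1r.
  by rewrite big1 ?addr0 // => j /negPf->; rewrite mul0r.
exists n, w => x.
have /vP[c cE] : k x \in im_pred k by apply/asboolP; exists x.
exists c; apply: jk; rewrite cE linear_sum; apply: eq_bigr => i _.
by rewrite linearZ /= wE.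
Qed.

(** A submodule of the middle term is an extension of its image in [N] by its
    intersection with [L]. *)
Lemma noetherian_mod_extension L M N (f : {linear L -> M}) (g : {linear M -> N}) :
  short_exact f g -> noetherian_mod L -> noetherian_mod N -> noetherian_mod M.
Proof.
move=> [jf ex sg] nL nN K k jk.
have [K' [i [ji exi]]] := kernel_exists (g \o k).
have [|h hE] := @factor_inj R _ _ _ f (k \o i) jf.
  by move=> x; apply/ex; exact: (short_exact_comp0 x exi).
have [Q [q seq]] := cokernel_short_exact ji; have [_ exq sq] := seq.
have [|h' hE'] := @factor_surj R _ _ _ q (g \o k) sq.
  by move=> x /exq[y <-]; exact: (short_exact_comp0 y exi).
apply: (fin_gen_extension seq).
  by apply: (nL _ h) => x y e; apply/ji/jk; have := congr1 f e; rewrite !hE.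
apply: (nN _ h'); apply: linear_injective => x; have [y <-] := sq x.
by rewrite hE' => /exi[z <-]; rewrite (short_exact_comp0 z exq).
Qed.

Lemma noetherian_mod_surj M N (f : {linear M -> N}) :
  surjective f -> noetherian_mod M -> noetherian_mod N.
Proof.
move=> sf nM K k jk.
have [T [t [jt ext]]] := kernel_exists ((f \o fst) \- (k \o snd) : {linear (M * K)%type -> N}).
have tE x : f (t x).1 = k (t x).2.
  by apply/subr0_eq; exact: (short_exact_comp0 x ext).
apply: (@fin_gen_surj T K (snd \o t)).
  move=> x; have [m me] := sf (k x).
  have /ext[y ye] : ((f \o fst) \- (k \o snd)) (m, x) = 0 by rewrite /= me subrr.
  by exists y; rewrite /= ye.
apply: (nM _ (fst \o t)); apply: linear_injective => x /= x1.
apply: jt; rewrite linear0; have := tE x; rewrite x1 linear0 => /esym/eqP.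
rewrite -(linear0 k) => /eqP/jk x2.
by case: (t x) x1 x2 => a b /= -> ->.
Qed.

Lemma noetherian_mod_row n : noetherian R -> noetherian_mod 'rV[R]_n.
Proof.
move=> noeth; elim: n => [|n IH].
  move=> K k jk; exists 0%N, (fun=> 0) => x; exists (fun=> 0).
  by rewrite big_ord0; apply: jk; rewrite !thinmx0.
have [f /bijective_inj_surj[_ sf]] := row_prod_isomorphic n.
apply: (noetherian_mod_surj sf).
apply: (noetherian_mod_extension (short_exact_prod _ _) _ IH).
exact: noetherian_mod_ring.
Qed.

Lemma fin_gen_sub M N (f : {linear M -> N}) :
  noetherian R -> injective f -> fin_gen N -> fin_gen M.
Proof.
move=> noeth jf /fin_gen_cover[n [g sg]].
exact: (noetherian_mod_surj sg (noetherian_mod_row noeth) jf).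
Qed.

Lemma row_projective n X Y (g : {linear X -> Y}) (c : {linear 'rV[R]_n -> Y}) :
  surjective g -> exists l : {linear 'rV[R]_n -> X}, forall x, g (l x) = c x.
Proof.
move=> sg.
have [v vE] : exists v : 'I_n -> X, forall i, g (v i) = c (delta_mx 0 i).
  by exists (fun i => projT1 (cid (sg (c (delta_mx 0 i))))) => i; case: cid.
exists (rowcomb v) => x; rewrite /= linear_sum linear_rowE.
by apply: eq_bigr => i _; rewrite linearZ /= vE.
Qed.

End FinGen.

(** * Resolving classes and resolution dimension *)

Section Resolving.
Variable R : comPzRingType.
Implicit Types A D E F K L M N P Q T X Y Z : lmodType R.

Lemma resolving_fin_gen (C : class (lmodType R)) X : resolving C -> C X -> fin_gen X.
Proof. by case=> -[fg _] _ _ _; exact: fg. Qed.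

Lemma resolving_iso (C : class (lmodType R)) X Y :
  resolving C -> isomorphic X Y -> C X -> C Y.
Proof. by case=> -[_ iso] _ _ _; exact: iso. Qed.

Lemma resolving_row (C : class (lmodType R)) n : resolving C -> C 'rV[R]_n.
Proof.
move=> rC; have [_ CR Cprod _] := rC; elim: n => [|n IH].
  suff /Cprod[] : C (R^o * 'rV[R]_0)%type by [].
  apply: (resolving_iso rC _ CR); apply: isomorphic_sym.
  apply: (@inj_surj_isomorphic _ _ _ (fst : {linear (R^o * 'rV[R]_0)%type -> R^o})).
    by case=> x u [y v] /= ->; rewrite (thinmx0 u) (thinmx0 v).
  by move=> y; exists (y, 0).
by apply: (resolving_iso rC (@row_prod_isomorphic R n)); apply/Cprod.
Qed.

Lemma resolving_extension (C : class (lmodType R)) L M N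
    (f : {linear L -> M}) (g : {linear M -> N}) :
  resolving C -> short_exact f g -> C L -> C N -> C M.
Proof.
move=> rC se CL CN; have [_ _ _ ex] := rC.
have fgL := resolving_fin_gen rC CL; have fgN := resolving_fin_gen rC CN.
by apply/(ex _ _ _ _ _ fgL (fin_gen_extension se fgL fgN) se CN).
Qed.

Lemma resolving_kernel (C : class (lmodType R)) L M N
    (f : {linear L -> M}) (g : {linear M -> N}) :
  noetherian R -> resolving C -> short_exact f g -> C M -> C N -> C L.
Proof.
move=> noeth rC se CM CN; have [_ _ _ ex] := rC; have [jf _ _] := se.
have fgM := resolving_fin_gen rC CM.
by apply/(ex _ _ _ _ _ (fin_gen_sub noeth jf fgM) fgM se CN).
Qed.

Lemma short_exact_prod_map K M N (K' M' N' : lmodType R)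
   (i : {linear K -> M}) (f : {linear M -> N})
   (i' : {linear K' -> M'}) (f' : {linear M' -> N'}) :
  short_exact i f -> short_exact i' f' ->
  exists (j : {linear (K * K')%type -> (M * M')%type})
    (g : {linear (M * M')%type -> (N * N')%type}), short_exact j g.
Proof.
move=> [ji exi sf] [ji' exi' sf'].
have lj : linear (fun x : K * K' => (i x.1, i' x.2) : M * M').
  by move=> a x y /=; rewrite !linearP.
have lg : linear (fun x : M * M' => (f x.1, f' x.2) : N * N').
  by move=> a x y /=; rewrite !linearP.
exists (mklin lj), (mklin lg); split.
- by case=> x y [z t] /= [/ji-> /ji'->].
- case=> x y; split=> [[/exi[u <-] /exi'[v <-]]|[[u v] [<- <-]]].
    by exists (u, v).
  by rewrite /= (short_exact_comp0 u exi) (short_exact_comp0 v exi').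
- by case=> x y; have [u <-] := sf x; have [v <-] := sf' y; exists (u, v).
Qed.

End Resolving.

Section ExtDim.
Variables (R : comPzRingType) (noeth : noetherian R).
Implicit Types C D : class (lmodType R).
Implicit Types K P X Y : lmodType R.

(** For [C] contained in [D] and [D] the modules of dimension at most [n], these
    are the modules of dimension at most [n + 1]. *)
Definition coker_class C D : class (lmodType R) := fun X =>
  exists (K P : lmodType R) (i : {linear K -> P}) (f : {linear P -> X}),
    [/\ short_exact i f, C P & D K].

(** The role of Schanuel's lemma: in the fibre product [T] of the two
    presentations, [T] is an extension of [P'] by [K], and [K'] is the kernel of
    [T -> P]. *)
Lemma kernel_independence D K P X (K' P' : lmodType R)
    (i : {linear K -> P}) (f : {linear P -> X})
    (i' : {linear K' -> P'}) (f' : {linear P' -> X}) :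
  resolving D -> short_exact i f -> D P -> D K ->
  short_exact i' f' -> D P' -> D K'.
Proof.
move=> rD se DP DK se' DP'.
have [T [a [b [a' [b' [seT seT']]]]]] := pullback_sequences se se'.
exact: (resolving_kernel noeth rD seT' (resolving_extension rD seT DK DP') DP).
Qed.

Variables (C D : class (lmodType R)).
Hypotheses (rC : resolving C) (rD : resolving D) (CD : sub_class C D).

Lemma coker_class_fin_gen X : coker_class C D X -> fin_gen X.
Proof.
case=> K [P [i [f [[_ _ sf] CP _]]]].
exact: (fin_gen_surj sf (resolving_fin_gen rC CP)).
Qed.

Lemma coker_class_kernel K P X (i : {linear K -> P}) (f : {linear P -> X}) :
  coker_class C D X -> short_exact i f -> D P -> D K.
Proof.
case=> K' [P' [i' [f' [se' CP' DK']]]] se DP.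
exact: (kernel_independence rD se' (CD CP') DK' se DP).
Qed.

Lemma coker_class_cokernel K P X (i : {linear K -> P}) (f : {linear P -> X}) :
  short_exact i f -> D P -> D K -> coker_class C D X.
Proof.
move=> se DP DK; have [_ _ sf] := se.
have /fin_gen_cover[n [g sg]] := fin_gen_surj sf (resolving_fin_gen rD DP).
have [L [l se']] := kernel_short_exact sg.
have CF := resolving_row n rC.
by exists L, 'rV[R]_n, l, g; split=> //; apply: (kernel_independence rD se DP DK se' (CD CF)).
Qed.

Lemma coker_class_sub : sub_class D (coker_class C D).
Proof.
move=> X DX; have /fin_gen_cover[n [g sg]] := resolving_fin_gen rD DX.
have [L [l se]] := kernel_short_exact sg.
have CF := resolving_row n rC; exists L, 'rV[R]_n, l, g; split=> //.
exact: (resolving_kernel noeth rD se (CD CF) DX).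
Qed.

(** For 0 -> X -> Y -> Z -> 0 choose a free cover of [Y].  Its kernel K and the
    kernel L of the composite onto [Z] fit into 0 -> K -> L -> X -> 0.  If [Z] is
    in the class, then L is in [D], and both implications follow by reading
    this sequence as a presentation of [X]. *)
Lemma coker_class_resolving : resolving (coker_class C D).
Proof.
have ex : forall (X Y Z : lmodType R) (u : {linear X -> Y}) (v : {linear Y -> Z}),
    fin_gen Y -> short_exact u v -> coker_class C D Z ->
    (coker_class C D Y <-> coker_class C D X).
  move=> X Y Z u v /fin_gen_cover[n [g sg]] se EZ.
  have CF := resolving_row n rC; have DF := CD CF.
  have [K [L [k [l [a [b [sek sel seab]]]]]]] := kernel_of_composite se sg.
  have DL := coker_class_kernel EZ sel DF.
  split=> [EY|EX].
    exact: (coker_class_cokernel seab DL (coker_class_kernel EY sek DF)).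
  by exists K, 'rV[R]_n, k, g; split=> //; exact: (coker_class_kernel EX seab DL).
split=> [|||L M N f g _]; last exact: ex.
- split=> [X|X Y [h bh]]; first exact: coker_class_fin_gen.
  have [jh sh] := bijective_inj_surj bh.
  case=> K [P [i [f [[ji exi sf] CP DK]]]]; exists K, P, i, (h \o f); split=> //.
  split=> // [y|y].
    by rewrite -exi /= -(linear0 h); split=> [/jh//|->].
  by have [x <-] := sh y; have [z <-] := sf x; exists z.
- by apply/coker_class_sub/CD; case: rC.
- move=> X Y; split=> [EXY|[EX EY]]; last first.
    apply/(ex _ _ _ _ _ _ (short_exact_prod X Y) EY) => //.
    by apply: fin_gen_prod; exact: coker_class_fin_gen.
  have fgXY := coker_class_fin_gen EXY.
  have /fin_gen_cover[n [g sg]] : fin_gen X.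
    by apply: (@fin_gen_surj _ _ _ fst _ fgXY) => x; exists (x, 0).
  have /fin_gen_cover[m [h sh]] : fin_gen Y.
    by apply: (@fin_gen_surj _ _ _ snd _ fgXY) => y; exists (0, y).
  have [K [k sek]] := kernel_short_exact sg.
  have [L [l sel]] := kernel_short_exact sh.
  have CF := resolving_row n rC; have CG := resolving_row m rC.
  have [j [d se]] := short_exact_prod_map sek sel.
  have [_ _ Dprod _] := rD.
  have /Dprod[DK DL] : D (K * L)%type.
    by apply: (coker_class_kernel EXY se); apply/Dprod; split; exact: CD.
  by split; [exists K, 'rV[R]_n, k, g|exists L, 'rV[R]_m, l, h].
Qed.

End ExtDim.

Section ResolutionDimension.
Variables (R : comPzRingType) (noeth : noetherian R).
Implicit Types C D : class (lmodType R).
Implicit Types K P X Y : lmodType R.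

Fixpoint dim_le C n : class (lmodType R) :=
  if n is k.+1 then coker_class C (dim_le C k) else C.

Lemma dim_le_sub C D n : sub_class C D -> sub_class (dim_le C n) (dim_le D n).
Proof.
move=> CD; elim: n => [|n IH] //= X [K [P [i [f [se CP DK]]]]].
by exists K, P, i, f; split=> //; [exact: CD|exact: IH].
Qed.

Lemma dim_le_resolving_sub C n : resolving C ->
  [/\ resolving (dim_le C n), sub_class C (dim_le C n)
    & sub_class (dim_le C n) (dim_le C n.+1)].
Proof.
move=> rC; elim: n => [|n [rn sn mn]] /=.
  by split=> //; exact: coker_class_sub.
have r' := coker_class_resolving noeth rC rn sn.
have s' : sub_class C (coker_class C (dim_le C n)) by move=> X /sn/mn.
by split=> //; exact: coker_class_sub.
Qed.

Lemma dim_le_resolving C n : resolving C -> resolving (dim_le C n).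
Proof. by case/(dim_le_resolving_sub n). Qed.

Lemma sub_dim_le C n : resolving C -> sub_class C (dim_le C n).
Proof. by case/(dim_le_resolving_sub n). Qed.

Lemma dim_le_mono C m n : resolving C -> (m <= n)%N ->
  sub_class (dim_le C m) (dim_le C n).
Proof.
move=> rC /subnK<-; elim: (n - m)%N => [|k IH] X // /IH.
by have [_ _] := dim_le_resolving_sub (k + m)%N rC; exact.
Qed.

Lemma dim_le_kernel C n K P X (i : {linear K -> P}) (f : {linear P -> X}) :
  resolving C -> short_exact i f -> dim_le C n P -> dim_le C n.+1 X ->
  dim_le C n K.
Proof.
move=> rC se DP DX; have [rn sn _] := dim_le_resolving_sub n rC.
exact: (coker_class_kernel noeth rn sn DX se DP).
Qed.

Lemma dim_le_cokernel C n K P X (i : {linear K -> P}) (f : {linear P -> X}) :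
  resolving C -> short_exact i f -> dim_le C n P -> dim_le C n K ->
  dim_le C n.+1 X.
Proof.
move=> rC se DP DK; have [rn sn _] := dim_le_resolving_sub n rC.
exact: (coker_class_cokernel noeth rC rn sn se DP DK).
Qed.

(** A resolution of the first syzygy is shifted by one and [P] is put in degree
    zero. *)
Lemma dim_le_has_resolution C n X :
  resolving C -> dim_le C n X -> has_resolution C X n.
Proof.
move=> rC; elim: n X => [|n IH] X /=.
  move=> CX; pose M k : lmodType R := if k is 0%N then X else 'rV[R]_0.
  exists M, (fun k => \0), idfun.
  split=> //.
  - by case.
  - by case=> // i _ x; rewrite (thinmx0 x).
  - by move=> x; exists x.
  - by move=> x; split=> [x0|[_ <-]//]; exists 0; exact: esym x0.
  - by move=> i x; split=> // _; exists 0; rewrite (thinmx0 x).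
case=> K [P [i [f [[ji exi sf] CP]]]] /IH[M [d [e [CM M0 se exe exd]]]].
pose M' k : lmodType R := if k is j.+1 then M j else P.
pose d' k : {linear M' k.+1 -> M' k} :=
  if k is j.+1 return {linear M' k.+1 -> M' k} then d j else (i \o e).
exists M', d', f; split=> //.
- by case=> // k; exact: CM.
- by case=> // k; exact: M0.
- move=> x; rewrite exi; split=> -[y <-]; last by exists (e y).
  by have [z <-] := se y; exists z.
- case=> [|k] x //=; last exact: exd.
  by rewrite -exe /= -(linear0 i); split=> [/ji//|->].
Qed.

Lemma has_resolution_dim_le C n X :
  resolving C -> has_resolution C X n -> dim_le C n X.
Proof.
move=> rC; elim: n X => [|n IH] X [M [d [e [CM M0 se exe exd]]]] /=.
  apply: (resolving_iso rC _ (CM 0%N isT)); apply: (inj_surj_isomorphic _ se).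
  apply: linear_injective => x /exe[y <-].
  by rewrite (M0 1%N isT y) linear0.
have [K [k sek]] := kernel_short_exact se; have [jk exk _] := sek.
have [|e' e'E] := @factor_inj _ _ _ _ k (d 0%N) jk.
  by move=> x; apply/exk/exe; exists x.
exists K, (M 0%N), k, e; split=> //; first exact: CM.
apply: IH; exists (fun j => M j.+1), (fun j => d j.+1), e'; split=> //.
- by move=> j jn; exact: CM.
- by move=> j jn; exact: M0.
- move=> x; have /exe[y ye] : e (k x) = 0 by apply/exk; exists x.
  by exists y; apply: jk; rewrite e'E.
- move=> x; rewrite -exd -e'E -(linear0 k); split=> [->//|/jk//].
Qed.

Lemma enat_least_le (P : class nat) n :
  enat_le (enat_least P) (Some n) <-> exists2 m, (m <= n)%N & P m.
Proof.
rewrite /enat_least; case: pselect => [exP|noP] /=; last first.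
  split=> // -[m _ Pm]; case: noP; exists m; exact/asboolP.
case: ex_minnP => k /asboolP Pk kmin; split=> [kn|[m mn Pm]]; first by exists k.
by apply: leq_trans mn; apply: kmin; exact/asboolP.
Qed.

Lemma resdim_le C X n : resolving C ->
  enat_le (resdim C X) (Some n) <-> dim_le C n X.
Proof.
move=> rC; rewrite enat_least_le; split=> [[m mn]|].
  by move/(has_resolution_dim_le rC); exact: dim_le_mono.
by move/(dim_le_has_resolution rC); exists n.
Qed.

Lemma DeltaP C X : resolving C -> Delta C X <-> exists n, dim_le C n X.
Proof.
move=> rC; split=> [[_]|[n dX]].
  case e : (resdim C X) => [n|] // _; exists n.
  by apply/(resdim_le _ _ rC); rewrite e /=.
split; first exact: (resolving_fin_gen (dim_le_resolving n rC) dX).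
by move/(resdim_le _ _ rC): dX; case: (resdim C X).
Qed.

Lemma sub_Delta C : resolving C -> sub_class C (Delta C).
Proof. by move=> rC X CX; apply/(DeltaP _ rC); exists 0%N. Qed.

Lemma Delta_resolving C : resolving C -> resolving (Delta C).
Proof.
move=> rC; have rn n := dim_le_resolving n rC.
have mono := @dim_le_mono C _ _ rC.
split=> [|||L M N f g fgL fgM se /(DeltaP _ rC)[n dN]].
- split=> [X []//|X Y iso /(DeltaP _ rC)[n dX]].
  by apply/(DeltaP _ rC); exists n; exact: (resolving_iso (rn n) iso dX).
- by apply: sub_Delta => //; case: rC.
- move=> X Y; split=> [/(DeltaP _ rC)[n]|[/(DeltaP _ rC)[n dX] /(DeltaP _ rC)[m dY]]].
    by case: (rn n) => _ _ h _ /h[dX dY]; split; apply/(DeltaP _ rC); exists n.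
  apply/(DeltaP _ rC); exists (maxn n m); case: (rn (maxn n m)) => _ _ h _.
  by apply/h; split; [apply: mono dX|apply: mono dY]; rewrite ?leq_maxl ?leq_maxr.
- split=> /(DeltaP _ rC)[m dX]; apply/(DeltaP _ rC); exists (maxn n m).
    apply: (resolving_kernel noeth (rn _) se);
      by [apply: mono dX; rewrite leq_maxr|apply: mono dN; rewrite leq_maxl].
  apply: (resolving_extension (rn _) se);
    by [apply: mono dX; rewrite leq_maxr|apply: mono dN; rewrite leq_maxl].
Qed.

(** In a finite resolution of [X] over [C] all syzygies lie in [D], so thickness
    brings them into [C] one after the other, starting from the last. *)
Lemma thick_finite_dim C D k X :
  thick_in C D -> resolving D -> dim_le C k X -> D X -> C X.
Proof.
move=> [rC CD thick] rD; elim: k X => [|k IH] X //= dX DX.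
have /fin_gen_cover[n [g sg]] := resolving_fin_gen rD DX.
have [K [l se]] := kernel_short_exact sg; have CF := resolving_row n rC.
apply: (thick _ _ _ _ _ se) => //; apply: IH.
  exact: (dim_le_kernel rC se (sub_dim_le _ rC CF) dX).
exact: (resolving_kernel noeth rD se (CD _ CF) DX).
Qed.

(** The [n]th syzygy of [X] lies in [D] and has finite [C]-dimension, hence lies
    in [C] by [thick_finite_dim]. *)
Lemma thick_dim_le C D k n X :
  thick_in C D -> resolving D -> dim_le C k X -> dim_le D n X -> dim_le C n X.
Proof.
move=> th rD; have [rC CD _] := th; elim: n X => [|n IH] X dX DX.
  exact: (thick_finite_dim th rD dX DX).
have /fin_gen_cover[m [g sg]] := resolving_fin_gen (dim_le_resolving n.+1 rD) DX.
have [K [l se]] := kernel_short_exact sg; have CF := resolving_row m rC.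
exists K, 'rV[R]_m, l, g; split=> //; apply: IH.
  exact: (resolving_kernel noeth (dim_le_resolving k rC) se (sub_dim_le _ rC CF) dX).
exact: (dim_le_kernel rD se (sub_dim_le _ rD (CD _ CF)) DX).
Qed.

(** Auslander-Buchweitz approximation.  Given 0 -> K -> P -> X -> 0 and an
    approximation K -> N of [K], the pushout E of [P] and [N] is an extension
    of a module of [D] by [P], hence lies in [D].  Embed E in a module A0 of [C]
    with cokernel in [D].  Then A0/N contains X = E/N with the same cokernel,
    and its dimension exceeds that of [N] by at most one. *)
Lemma cogenerated_approximation C D n X :
  resolving C -> resolving D -> cogenerates C D -> dim_le D n X ->
  exists (N Y : lmodType R) (f : {linear X -> N}) (g : {linear N -> Y}),
    [/\ short_exact f g, dim_le C n N & D Y].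
Proof.
move=> rC rD [CD cog]; elim: n X => [|n IH] X /=; first exact: cog.
case=> K [P [i [f [se DP /IH[N [Y [u [v [se' dN DY]]]]]]]]].
have [E [a [b [c [e [seab sece]]]]]] := pushout_sequences se se'.
have /cog[A [Z [s [t [sest CA DZ]]]]] := resolving_extension rD seab DP DY.
have [Q [q [x [y [seq sexy]]]]] := cokernel_of_composite sece sest.
exists Q, Z, x, y; split=> //.
exact: (dim_le_cokernel rC seq (sub_dim_le n rC CA) dN).
Qed.

End ResolutionDimension.

(** * Localization at a prime *)

Section Localize.
Variables (R : comPzRingType) (p : spec R).
Implicit Types L M N X Y : lmodType R.
Local Notation Rp := (loc_ring p).

Lemma loc_zero M : (0 : loc_mod p M) = frac 0 (denom1 p).
Proof. by []. Qed.

Lemma frac_eq0 M (m : M) (s : denom p) :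
  frac m s = 0 <-> exists u : denom p, den u *: m = 0.
Proof.
rewrite loc_zero frac_eq; split=> -[u e].
  by exists u; move: e; rewrite /= scale1r !scaler0.
by exists u; rewrite /= scale1r !scaler0.
Qed.

Lemma frac_cancel M (m : M) (u s : denom p) :
  frac (den u *: m) (denomM u s) = frac m s.
Proof.
apply/frac_eq; exists (denom1 p) => /=; rewrite !scale1r scalerA.
by rewrite mulrC.
Qed.

Lemma frac_zmod_morphism M (s : denom p) : zmod_morphism (fun m : M => frac m s).
Proof.
move=> m n; have e : - frac n s = frac (- n) s by exact: loc_oppE.
rewrite e frac_add -!scalerDr; exact/esym/frac_cancel.
Qed.

Lemma fracD M (m n : M) (s : denom p) : frac (m + n) s = frac m s + frac n s.
Proof. by rewrite frac_add -!scalerDr frac_cancel. Qed.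

Lemma frac0 M (s : denom p) : frac (0 : M) s = 0.
Proof. by apply/frac_eq0; exists s; rewrite scaler0. Qed.

Lemma frac_sum M n (m : 'I_n -> M) (s : denom p) :
  frac (\sum_i m i) s = \sum_i frac (m i) s.
Proof.
by apply: (big_morph (fun x => frac x s)); [move=> x y; exact: fracD|exact: frac0].
Qed.

(** The image of [a] in the localized ring. *)
Definition loc_scalar (a : R) : Rp := rfrac a (denom1 p).

Lemma frac_scalar M a (m : M) (s : denom p) :
  frac (a *: m) s = loc_scalar a *: frac m s.
Proof.
rewrite /loc_scalar frac_scale; apply/frac_eq; exists (denom1 p).
by rewrite /= mul1r.
Qed.

Lemma frac_denominator M (m : M) (s : denom p) :
  frac m s = rfrac 1 s *: frac m (denom1 p).
Proof.
rewrite frac_scale scale1r; apply/frac_eq; exists (denom1 p).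
by rewrite /= mulr1.
Qed.

Lemma loc_scalarV (s : denom p) : rfrac 1 s * loc_scalar (den s) = 1.
Proof.
rewrite /loc_scalar rfrac_mul; apply/rfrac_eq; exists (denom1 p) => /=.
by rewrite !(mul1r, mulr1).
Qed.

Lemma loc_scalar_inj (V : lmodType Rp) (s : denom p) (x y : V) :
  loc_scalar (den s) *: x = loc_scalar (den s) *: y -> x = y.
Proof.
move=> e; rewrite -[x]scale1r -[y]scale1r -(loc_scalarV s).
by rewrite -!scalerA e.
Qed.

Definition loc_map_fun M N (h : {linear M -> N}) (x : loc_mod p M) : loc_mod p N :=
  frac (h (repr x).1) (repr x).2.

Lemma loc_map_funE M N (h : {linear M -> N}) m s :
  loc_map_fun h (frac m s) = frac (h m) s.
Proof.
have [u e] := repr_frac m s; apply/frac_eq; exists u.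
by have := congr1 h e; rewrite !(linearZ_LR h).
Qed.

Lemma loc_map_linear M N (h : {linear M -> N}) : linear (loc_map_fun h).
Proof.
move=> a x y; have [b [s ->]] := rfracP a; have [m [t ->]] := fracP x.
have [n [w ->]] := fracP y.
by rewrite frac_scale frac_add !loc_map_funE frac_scale frac_add linearD !(linearZ_LR h).
Qed.

(** Sealed, so that only the formula on fractions is available: the chosen
    representatives in [loc_map_fun] would otherwise surface when rewriting. *)
Lemma loc_map_sig M N (h : {linear M -> N}) :
  {f : {linear loc_mod p M -> loc_mod p N} | forall m s, f (frac m s) = frac (h m) s}.
Proof. by exists (mklin (loc_map_linear h)) => m s; exact: loc_map_funE. Qed.

Definition loc_map M N (h : {linear M -> N}) : {linear loc_mod p M -> loc_mod p N} :=
  sval (loc_map_sig h).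

Lemma loc_mapE M N (h : {linear M -> N}) m s : loc_map h (frac m s) = frac (h m) s.
Proof. exact: (svalP (loc_map_sig h)). Qed.

Lemma loc_map_exact L M N (f : {linear L -> M}) (g : {linear M -> N}) :
  exact_at f g -> exact_at (loc_map f) (loc_map g).
Proof.
move=> ex y; split=> [|[x <-]]; last first.
  have [l [s ->]] := fracP x; rewrite !loc_mapE.
  by rewrite (short_exact_comp0 l ex) frac0.
have [m [s ->]] := fracP y; rewrite loc_mapE => /frac_eq0[u].
rewrite -linearZ => /ex[l le]; exists (frac l (denomM u s)).
by rewrite loc_mapE le frac_cancel.
Qed.

Lemma loc_map_surj M N (f : {linear M -> N}) :
  surjective f -> surjective (loc_map f).
Proof.
move=> sf y; have [n [s ->]] := fracP y; have [m <-] := sf n.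
by exists (frac m s); rewrite loc_mapE.
Qed.

Lemma loc_map_inj M N (f : {linear M -> N}) :
  injective f -> injective (loc_map f).
Proof.
move=> jf; apply: linear_injective => x; have [m [s ->]] := fracP x.
rewrite loc_mapE => /frac_eq0[u]; rewrite -linearZ -(linear0 f) => /jf e.
by apply/frac_eq0; exists u.
Qed.

Lemma loc_map_short_exact L M N (f : {linear L -> M}) (g : {linear M -> N}) :
  short_exact f g -> short_exact (loc_map f) (loc_map g).
Proof.
by move=> [jf ex sg]; split; [exact: loc_map_inj|exact: loc_map_exact|exact: loc_map_surj].
Qed.

Lemma loc_map_iso M N : isomorphic M N -> isomorphic (loc_mod p M) (loc_mod p N).
Proof.
case=> f /bijective_inj_surj[jf sf].
by apply: (@inj_surj_isomorphic _ _ _ (loc_map f)); [exact: loc_map_inj|exact: loc_map_surj].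
Qed.

Lemma loc_fin_gen M : fin_gen M -> fin_gen (loc_mod p M).
Proof.
move=> [n [v vP]]; exists n, (fun i => frac (v i) (denom1 p)) => x.
have [m [s ->]] := fracP x; have [c ->] := vP m.
exists (fun i => rfrac (c i) s); rewrite frac_sum; apply: eq_bigr => i _.
rewrite frac_scale; apply/frac_eq; exists (denom1 p).
by rewrite /= mulr1.
Qed.

Lemma loc_ring_isomorphic : isomorphic (loc_mod p R^o) Rp^o.
Proof.
have l : linear (fun x : loc_mod p R^o => x : Rp^o) by [].
by apply: (@inj_surj_isomorphic _ _ _ (mklin l)) => // x; exists x.
Qed.

Lemma loc_prod_isomorphic M N :
  isomorphic (loc_mod p (M * N)%type) (loc_mod p M * loc_mod p N)%type.
Proof.
have l : linear (fun x : loc_mod p (M * N)%type =>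
    (loc_map fst x, loc_map snd x) : loc_mod p M * loc_mod p N).
  by move=> a x y; rewrite !linearP.
apply: (@inj_surj_isomorphic _ _ _ (mklin l)).
  apply: linear_injective => x; have [[m n] [s ->]] := fracP x.
  move=> [/=]; rewrite !loc_mapE => /frac_eq0[u /= mu] /frac_eq0[v /= nv].
  apply/frac_eq0; exists (denomM u v); congr (_, _) => /=; last by rewrite -scalerA nv scaler0.
  by rewrite mulrC -scalerA mu scaler0.
move=> [x y]; have [m [s ->]] := fracP x; have [n [t ->]] := fracP y.
exists (frac (den t *: m, den s *: n) (denomM s t)) => /=; rewrite !loc_mapE /=.
by rewrite frac_cancel; congr (_, _); apply/frac_eq; exists (denom1 p); rewrite /= !scale1r scalerA.
Qed.

(** An ideal of the localized ring is generated by the numerators it contains. *)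
Lemma loc_noetherian : noetherian R -> noetherian Rp.
Proof.
move=> noeth I [I0 IP].
have ID x y : x \in I -> y \in I -> x + y \in I.
  by move=> xI yI; have := IP 1 x y xI yI; rewrite scale1r.
have IZ (a : Rp) (x : Rp^o) : x \in I -> a *: x \in I.
  by move=> xI; have := IP a x 0 xI I0; rewrite addr0.
pose J : {pred R^o} := fun a => (loc_scalar a : Rp^o) \in I.
have scE (x : R) : loc_scalar x = frac (x : R^o) (denom1 p) by [].
have J_closed : submod_closed J.
  split=> [|a x y]; rewrite !unfold_in scE ?frac0 // => xJ yJ.
  by rewrite scE fracD frac_scalar; apply: ID => //; exact: IZ.
have [n [v vP]] := noeth J J_closed.
have vJ i : (v i : R^o) \in J.
  apply/vP; exists (fun j => (j == i)%:R); rewrite (bigD1 i) //= eqxx mul1r.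
  by rewrite big1 ?addr0 // => j /negPf->; rewrite mul0r.
exists n, (fun i => loc_scalar (v i)) => x; split=> [xI|[c ->]]; last first.
  by elim/big_ind: _ => // i _; apply: IZ; exact: vJ.
have [a [s xE]] := rfracP x.
have /vP[c aE] : (a : R^o) \in J.
  rewrite unfold_in; have -> : loc_scalar a = loc_scalar (den s) *: (x : Rp^o).
    rewrite xE /loc_scalar; apply: etrans (esym (rfrac_mul _ _ _ _)).
    by apply/rfrac_eq; exists (denom1 p) => /=; rewrite !mul1r.
  exact: IZ.
exists (fun i => rfrac (c i) s); rewrite xE aE.
apply: etrans (@frac_sum R^o n _ s) _; apply: eq_bigr => i _.
rewrite /loc_scalar rfrac_mul; apply/rfrac_eq; exists (denom1 p).
by rewrite /= mulr1.
Qed.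

(** The localization of a free module is free; the lift is built on the images
    of the standard basis, through the localized coordinate functions. *)
Lemma loc_row_projective n (V W : lmodType Rp) (g : {linear V -> W})
    (c : {linear loc_mod p 'rV[R]_n -> W}) :
  surjective g ->
  exists l : {linear loc_mod p 'rV[R]_n -> V}, forall x, g (l x) = c x.
Proof.
move=> sg.
pose e i : loc_mod p 'rV[R]_n := frac (delta_mx 0 i) (denom1 p).
have [v vE] : exists v : 'I_n -> V, forall i, g (v i) = c (e i).
  by exists (fun i => projT1 (cid (sg (c (e i))))) => i; case: cid.
have lc i : linear (fun x : 'rV[R]_n => x 0 i : R^o) by move=> a x y; rewrite !mxE.
pose k i (x : loc_mod p 'rV[R]_n) : Rp := loc_map (mklin (lc i)) x.
have kE i m s : k i (frac m s) = rfrac (m 0 i) s by exact: loc_mapE.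
have kP i a x y : k i (a *: x + y) = a * k i x + k i y.
  exact: (linearP (loc_map (mklin (lc i)))).
have ll : linear (fun x => \sum_i k i x *: v i).
  move=> a x y; rewrite scaler_sumr -big_split /=; apply: eq_bigr => i _.
  by rewrite kP scalerDl scalerA.
exists (mklin ll) => x /=; have [m [s ->]] := fracP x.
rewrite linear_sum {2}[m]row_sum_delta frac_sum linear_sum.
apply: eq_bigr => i _; rewrite linearZ /= vE kE -linearZ /=; congr (c _).
by rewrite frac_scale; apply/frac_eq; exists (denom1 p); rewrite /= mulr1.
Qed.

Lemma prod_denom n (s : 'I_n -> denom p) (P : pred 'I_n) :
  exists t : denom p, den t = \prod_(i | P i) den (s i).
Proof.
elim/big_ind: _ => [|x y [t <-] [u <-]|i _]; first by exists (denom1 p).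
  by exists (denomM t u).
by exists (s i).
Qed.

Lemma common_denominator M n (x : 'I_n -> loc_mod p M) :
  exists (m : 'I_n -> M) (s : denom p), forall i, x i = frac (m i) s.
Proof.
have [m0 m0P] : exists m : 'I_n -> M, forall i, exists s, x i = frac (m i) s.
  by exists (fun i => projT1 (cid (fracP (x i)))) => i; case: cid.
have [s0 s0P] : exists s : 'I_n -> denom p, forall i, x i = frac (m0 i) (s i).
  by exists (fun i => projT1 (cid (m0P i))) => i; case: cid.
have [s sE] := prod_denom s0 predT.
exists (fun i => (\prod_(j | j != i) den (s0 j)) *: m0 i), s => i.
have [t tE] := prod_denom s0 (predC1 i).
rewrite s0P -(frac_cancel (m0 i) t (s0 i)) tE.
by apply/frac_eq; exists (denom1 p); rewrite /= sE tE (bigD1 i) //= mulrC.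
Qed.

Lemma common_annihilator M N (h : {linear M -> N}) :
  fin_gen M -> (forall x : M, exists u : denom p, den u *: h x = 0) ->
  exists u : denom p, forall x, den u *: h x = 0.
Proof.
move=> [n [v vP]] ann.
have [s sP] : exists s : 'I_n -> denom p, forall i, den (s i) *: h (v i) = 0.
  by exists (fun i => projT1 (cid (ann (v i)))) => i; case: cid.
(* The product of annihilators of the images of the generators. *)
have [u uE] := prod_denom s predT; exists u => x; have [c ->] := vP x.
rewrite linear_sum scaler_sumr big1 // => i _.
rewrite (linearZ_LR h) scalerA mulrC uE (bigD1 i) //=.
by rewrite [den (s i) * _]mulrC mulrA -scalerA sP scaler0.
Qed.

(** Hom of a finitely presented module commutes with localization: [s] clears
    the denominators of the values on generators, and a further multiple kills
    the finitely many relations. *)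
Lemma loc_map_lift M N (phi : {linear loc_mod p M -> loc_mod p N}) :
  noetherian R -> fin_gen M ->
  exists (s : denom p) (h : {linear M -> N}),
    forall x, loc_map h x = loc_scalar (den s) *: phi x.
Proof.
move=> noeth /fin_gen_cover[n [q sq]].
have [K [k [jk exk sk]]] := kernel_short_exact sq.
have fgK := fin_gen_sub noeth jk (fin_gen_row R n).
have [y [s ys]] := common_denominator
  (fun i => phi (frac (q (delta_mx 0 i)) (denom1 p))).
pose h0 := rowcomb y.
have h0E c : phi (frac (q c) (denom1 p)) = frac (h0 c) s.
  rewrite (linear_rowE q) frac_sum linear_sum (linear_rowE h0) frac_sum.
  apply: eq_bigr => i _; rewrite rowcomb_delta !frac_scalar linearZ /=.
  by rewrite -ys.
have [|u uP] := @common_annihilator K N (h0 \o k) fgK.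
  move=> x; apply/(@frac_eq0 N _ s); rewrite /= -h0E.
  by rewrite (short_exact_comp0 x exk) frac0 linear0.
have [|h hE] := @factor_surj _ _ _ _ q (den u \*: h0) sq.
  by move=> c /exk[x <-]; exact: uP.
exists (denomM u s), h => x; have [m [t ->]] := fracP x; have [c <-] := sq m.
rewrite loc_mapE hE [in RHS]frac_denominator (linearZ_LR phi) h0E.
rewrite (frac_scale 1) scale1r -frac_scalar.
apply/frac_eq; exists (denom1 p) => /=.
by rewrite !scale1r !scalerA; congr (_ *: _); ring.
Qed.

Lemma loc_map_eq M N (h h' : {linear M -> N}) :
  fin_gen M -> (forall x, loc_map h x = loc_map h' x) ->
  exists u : denom p, forall x, den u *: h x = den u *: h' x.
Proof.
move=> fg e; have [|u uP] := @common_annihilator M N (h \- h') fg.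
  move=> x; apply/(@frac_eq0 N _ (denom1 p)).
  have ex := e (frac x (denom1 p)); rewrite !loc_mapE in ex.
  by rewrite [LHS](frac_zmod_morphism (denom1 p)) ex subrr.
by exists u => x; apply/subr0_eq; rewrite -scalerBr; exact: uP.
Qed.

End Localize.

(** * The localization of a resolving class *)

Definition retract (R : comPzRingType) (Y N : lmodType R) : Prop :=
  exists (i : {linear Y -> N}) (r : {linear N -> Y}), forall y, r (i y) = y.

Section Retracts.
Variable R : comPzRingType.
Implicit Types X Y Z M N : lmodType R.

Lemma iso_retract X Y : isomorphic X Y -> retract X Y.
Proof.
case=> f /bijective_inj_surj[jf sf].
have [|g gE] := @factor_surj _ _ _ _ f idfun sf; last by exists f, g.
by move=> x; rewrite -(linear0 f) => /jf.
Qed.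

Lemma retract_trans Y X Z : retract X Y -> retract Y Z -> retract X Z.
Proof.
by move=> [i [r ir]] [j [s js]]; exists (j \o i), (r \o s) => y; rewrite /= js ir.
Qed.

Lemma retract_fst X Y : retract X (X * Y)%type.
Proof. by exists (inl_lin X Y), fst. Qed.

Lemma retract_snd X Y : retract Y (X * Y)%type.
Proof. by exists (inr_lin X Y), snd. Qed.

Lemma retract_prod X Y M N :
  retract X M -> retract Y N -> retract (X * Y)%type (M * N)%type.
Proof.
move=> [i [r ir]] [j [s js]].
have l1 : linear (fun x : X * Y => (i x.1, j x.2) : M * N).
  by move=> a x y /=; rewrite !linearP.
have l2 : linear (fun x : M * N => (r x.1, s x.2) : X * Y).
  by move=> a x y /=; rewrite !linearP.
by exists (mklin l1), (mklin l2) => -[x y] /=; rewrite ir js.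
Qed.

(** The complement is the kernel of the retraction. *)
Lemma retract_complement Y N : retract Y N ->
  exists2 Z : lmodType R, retract Z N & isomorphic (Y * Z)%type N.
Proof.
move=> [i [r ir]]; have [Z [k [jk exk]]] := kernel_exists r.
have [|t tE] := @factor_inj _ _ _ _ k (idfun \- (i \o r) : {linear N -> N}) jk.
  by move=> x; apply/exk; rewrite /= linearB /= ir subrr.
have rk z : r (k z) = 0 by exact: (short_exact_comp0 z exk).
exists Z.
  by exists k, t => z; apply: jk; rewrite tE /= rk linear0 subr0.
apply: (@inj_surj_isomorphic _ _ _ ((i \o fst) \+ (k \o snd))).
  apply: linear_injective => -[y z] /= e.
  have y0 : y = 0 by have := congr1 r e; rewrite linearD /= ir rk addr0 linear0.
  move: e; rewrite y0 linear0 add0r -(linear0 k) => /jk->; congr (_, _).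
by move=> x; exists (r x, t x); rewrite /= tE /= addrC subrK.
Qed.

Lemma short_exact_iso X Y Z (X' Z' : lmodType R)
    (f : {linear X -> Y}) (g : {linear Y -> Z}) :
  short_exact f g -> isomorphic X X' -> isomorphic Z Z' ->
  exists (f' : {linear X' -> Y}) (g' : {linear Y -> Z'}), short_exact f' g'.
Proof.
move=> [jf ex sg] /isomorphic_sym[a /bijective_inj_surj[ja sa]] [b /bijective_inj_surj[jb sb]].
exists (f \o a), (b \o g); split=> [x y /jf/ja//|y|z].
  rewrite -[X in _ = X](linear0 b); split=> [/jb/ex[x <-]|[x <-]].
    by have [x' <-] := sa x; exists x'.
  by rewrite /= (short_exact_comp0 (a x) ex).
by have [y <-] := sb z; have [x <-] := sg y; exists x.
Qed.

End Retracts.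

Section LocalClass.
Variables (R : comPzRingType) (noeth : noetherian R) (p : spec R).
Variables (C : class (lmodType R)) (rC : resolving C).
Local Notation Rp := (loc_ring p).
Implicit Types V W X Y Z : lmodType Rp.

(** An explicit description of add C_p, see [add_locE]: as [C] is closed under
    sums, sums of summands of the N_p are again summands of some N_p. *)
Definition loc_retract : class (lmodType Rp) := fun Y =>
  exists2 N, C N & retract Y (loc_mod p N).

Lemma loc_retract_trans X Y : retract X Y -> loc_retract Y -> loc_retract X.
Proof. by move=> XY [N CN YN]; exists N => //; exact: retract_trans YN. Qed.

Lemma loc_retract_loc N : C N -> loc_retract (loc_mod p N).
Proof. by move=> CN; exists N => //; apply: iso_retract; exists idfun; exists id. Qed.

Lemma loc_retract_prod X Y :
  loc_retract X -> loc_retract Y -> loc_retract (X * Y)%type.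
Proof.
move=> [M CM XM] [N CN YN]; exists (M * N)%type; first by case: rC => _ _ h _; apply/h.
apply: retract_trans (retract_prod XM YN) _.
exact/iso_retract/isomorphic_sym/loc_prod_isomorphic.
Qed.

Lemma loc_retract_add_closed : add_closed loc_retract.
Proof.
split.
- split=> [X [N CN [i [r ir]]]|X Y iso].
    apply: (@fin_gen_surj _ _ _ r); first by move=> y; exists (i y).
    exact/loc_fin_gen/(resolving_fin_gen rC CN).
  exact/loc_retract_trans/iso_retract/isomorphic_sym.
- move=> X X0; exists R^o; first by case: rC.
  by exists \0, \0 => x; rewrite [RHS]X0.
- exact: loc_retract_prod.
- by move=> X Y; apply: loc_retract_trans; exact: retract_fst.
Qed.

Lemma add_locE : add_loc p C = loc_retract.
Proof.
apply: functional_extensionality_dep => Y; apply: propositional_extensionality.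
split=> [h|[N CN YN] D aD sD].
  by apply: h; [exact: loc_retract_add_closed|move=> _ [N CN ->]; exact: loc_retract_loc].
have [Z _ iso] := retract_complement YN.
have [[_ iD] _ _ sumD] := aD.
apply: (sumD _ Z); apply: iD (isomorphic_sym iso) _.
by apply: sD; exists N.
Qed.

(** Clearing denominators, [g] becomes the localization of a map [h] from [L] to
    [N], which need not be surjective; adding a free cover [c] of [N] to it gives
    a surjection [H] from L + F whose kernel [K] is in [C].  Locally [c] lifts
    along [g], which splits the free summand off: [X] is a retract of K_p. *)
Lemma loc_retract_loc_kernel L N X (u : {linear X -> loc_mod p L})
    (g : {linear loc_mod p L -> loc_mod p N}) :
  short_exact u g -> C L -> C N -> loc_retract X.
Proof.
move=> [ju exu sg] CL CN.
have [s [h hE]] := loc_map_lift g noeth (resolving_fin_gen rC CL).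
have /fin_gen_cover[n [c sc]] := resolving_fin_gen rC CN.
have CLF : C (L * 'rV[R]_n)%type.
  by case: rC => _ _ hp _; apply/hp; split=> //; exact: resolving_row.
pose H : {linear (L * 'rV[R]_n)%type -> N} := (h \o fst) \+ (c \o snd).
have sH : surjective H.
  by move=> y; have [x <-] := sc y; exists (0, x); rewrite /= linear0 add0r.
have [K [k sek]] := kernel_short_exact sH.
have CK := resolving_kernel noeth rC sek CLF CN.
have [jk exk _] := loc_map_short_exact p sek.
have HE z : loc_map p H z =
    loc_scalar p (den s) *: g (loc_map p fst z) + loc_map p c (loc_map p snd z).
  rewrite -hE; have [[x y] [t ->]] := fracP z; rewrite !loc_mapE /= -fracD.
  by [].
pose g' := loc_scalar p (den s) \*: g.
have sg' : surjective g'.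
  move=> y; have [x xE] := sg (rfrac 1 s *: y); exists x.
  by rewrite /g' /= xE scalerA mulrC loc_scalarV scale1r.
have [l lE] := loc_row_projective (loc_map p c) sg'.
(* A projection onto L_p through which s g becomes the localization of H. *)
pose rho : {linear loc_mod p (L * 'rV[R]_n)%type -> loc_mod p L} :=
  loc_map p fst \+ (l \o loc_map p snd).
have rhoE z : loc_scalar p (den s) *: g (rho z) = loc_map p H z.
  by rewrite HE -lE /rho /= linearD scalerDr.
have fl z : loc_map p fst (loc_map p (inl_lin L 'rV[R]_n) z) = z.
  by have [x [t ->]] := fracP z; rewrite !loc_mapE.
have sl z : loc_map p snd (loc_map p (inl_lin L 'rV[R]_n) z) = 0.
  by have [x [t ->]] := fracP z; rewrite !loc_mapE frac0.
have [|i iE] := @factor_inj _ _ _ _ (loc_map p k) (loc_map p (inl_lin L 'rV[R]_n) \o u) jk.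
  move=> x; apply/exk; rewrite HE /= fl sl linear0 addr0.
  by rewrite (short_exact_comp0 x exu) scaler0.
have [|r rE] := @factor_inj _ _ _ _ u (rho \o loc_map p k) ju.
  move=> x; apply/exu; apply: (@loc_scalar_inj _ _ _ s).
  by rewrite rhoE (short_exact_comp0 x exk) scaler0.
exists K => //; exists i, r => x; apply: ju.
by rewrite rE /= iE /rho /= fl sl linear0 addr0.
Qed.

(** Extensions of N_p by L_p are extensions of [N] by [L], up to a denominator.
    Concretely, from a free presentation 0 -> K -> F -> N -> 0 the extension
    gives a map K_p -> L_p; a multiple of it by a unit comes from a map [a] from
    [K] to [L], and the pushout [E] of [a] along K -> F localizes to [Y]. *)
Lemma loc_retract_loc_extension L N Y (u : {linear loc_mod p L -> Y})
    (g : {linear Y -> loc_mod p N}) :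
  short_exact u g -> C L -> C N -> loc_retract Y.
Proof.
move=> [ju exu sg] CL CN.
have /fin_gen_cover[n [c sc]] := resolving_fin_gen rC CN.
have CF := resolving_row n rC.
have [K [j sej]] := kernel_short_exact sc.
have CK := resolving_kernel noeth rC sej CF CN.
have [jj exj sc'] := loc_map_short_exact p sej.
have [psi psiE] := loc_row_projective (loc_map p c) sg.
have [|phi phiE] := @factor_inj _ _ _ _ u (psi \o loc_map p j) ju.
  by move=> x; apply/exu; rewrite /= psiE (short_exact_comp0 x exj).
have [s [a aE]] := loc_map_lift phi noeth (resolving_fin_gen rC CK).
have [E [q [e [sq qk see]]]] := pushout_exists a sej.
have CE := resolving_extension rC see CL CN.
have lw : linear (fun x : K => (j x, - a x) : 'rV[R]_n * L).
  by move=> b x y /=; rewrite !linearP.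
have exq : exact_at (loc_map p (mklin lw)) (loc_map p q).
  apply: loc_map_exact => -[x y]; rewrite qk.
  by split=> [[k [-> ->]]|[k [<- <-]]]; exists k.
have wE x : loc_map p (mklin lw) x =
    loc_map p (inl_lin _ _) (loc_map p j x) - loc_map p (inr_lin _ _) (loc_map p a x).
  have [m [t ->]] := fracP x; rewrite !loc_mapE -(frac_zmod_morphism t).
  by congr (frac _ _); congr (_, _) => /=; rewrite ?subr0 ?sub0r.
pose S := loc_scalar p (den s).
(* The unit S turns psi and u, which restrict to u phi on K_p, into a map that
   vanishes on the pairs (j k, - a k), since a localizes to S phi. *)
pose om : {linear loc_mod p ('rV[R]_n * L)%type -> Y} :=
  (S \*: (psi \o loc_map p fst)) \+ (u \o loc_map p snd).
have fl z : loc_map p fst (loc_map p (inl_lin 'rV[R]_n L) z) = z.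
  by have [x [t ->]] := fracP z; rewrite !loc_mapE.
have sl z : loc_map p snd (loc_map p (inl_lin 'rV[R]_n L) z) = 0.
  by have [x [t ->]] := fracP z; rewrite !loc_mapE frac0.
have fr z : loc_map p fst (loc_map p (inr_lin 'rV[R]_n L) z) = 0.
  by have [x [t ->]] := fracP z; rewrite !loc_mapE frac0.
have sr z : loc_map p snd (loc_map p (inr_lin 'rV[R]_n L) z) = z.
  by have [x [t ->]] := fracP z; rewrite !loc_mapE.
have omE x y : om (loc_map p (inl_lin _ _) x + loc_map p (inr_lin _ _) y)
    = S *: psi x + u y.
  by rewrite /om /= !linearD /= fl sl fr sr !linear0 addr0 add0r.
have decomp z : exists x y,
    z = loc_map p (inl_lin 'rV[R]_n L) x + loc_map p (inr_lin 'rV[R]_n L) y.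
  have [[m l] [t ->]] := fracP z; exists (frac m t), (frac l t).
  rewrite !loc_mapE -fracD; congr (frac _ _).
  by congr (_, _) => /=; rewrite ?addr0 ?add0r.
have [|th thE] := @factor_surj _ _ _ _ (loc_map p q) om (@loc_map_surj _ p _ _ _ sq).
  move=> z /exq[x <-]; rewrite wE -linearN omE linearN aE linearZ /= phiE /=.
  by rewrite subrr.
exists E => //; apply: iso_retract; apply: isomorphic_sym; apply: (@inj_surj_isomorphic _ _ _ th).
  apply: linear_injective => t; have [z <-] := @loc_map_surj _ p _ _ _ sq t.
  rewrite thE; have [x [y ->]] := decomp z; rewrite omE => e0.
  have /exj[k ke] : loc_map p c x = 0.
    apply: (@loc_scalar_inj _ _ _ s); rewrite scaler0 -psiE -linearZ.
    by have := congr1 g e0; rewrite linearD (short_exact_comp0 y exu) addr0 linear0.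
  have ye : y = - loc_map p a k.
    apply: ju; rewrite linearN aE linearZ /= phiE /= ke.
    by apply/eqP; rewrite -addr_eq0 addrC e0.
  by apply/exq; exists k; rewrite wE ke ye linearN.
move=> y; have [x xE] := sc' (g y).
have /exu[l lE] : g (y - psi x) = 0 by rewrite linearB /= psiE xE subrr.
exists (loc_map p q (loc_map p (inl_lin _ _) (rfrac 1 s *: x) + loc_map p (inr_lin _ _) l)).
rewrite thE omE linearZ /= scalerA mulrC loc_scalarV scale1r lE addrC.
by rewrite subrK.
Qed.

(** Adding the complement [Z'] of [Z] to the sequence makes the right term some
    N_p.  The middle term is then a retract of some L_p, and [X] is a retract of
    the kernel of L_p -> N_p. *)
Lemma loc_retract_kernel X Y Z (f : {linear X -> Y}) (g : {linear Y -> Z}) :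
  short_exact f g -> loc_retract Y -> loc_retract Z -> loc_retract X.
Proof.
move=> se mY [N CN ZN]; have [Z' Z'N iso] := retract_complement ZN.
have se' := short_exact_prod 'rV[Rp]_0 Z'.
have [f1 [g1 se1]] := short_exact_prod_map se se'.
have isoX : isomorphic (X * 'rV[Rp]_0)%type (X * 'rV[Rp]_0)%type by exists idfun; exists id.
have [f2 [g2 [j2 ex2 s2]]] := short_exact_iso se1 isoX iso.
apply: loc_retract_trans (retract_fst X 'rV[Rp]_0) _.
have [L CL [i [r ir]]] : loc_retract (Y * ('rV[Rp]_0 * Z'))%type.
  apply: loc_retract_prod => //; apply: loc_retract_prod.
    have [_ + _ _] := loc_retract_add_closed; apply=> x; exact: thinmx0.
  by exists N.
have sr : surjective r by move=> y; exists (i y).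
have sgr : surjective (g2 \o r).
  by move=> z; have [y <-] := s2 z; have [x <-] := sr y; exists x.
have [K [k [jk exk sk]]] := kernel_short_exact sgr.
apply: loc_retract_trans (loc_retract_loc_kernel (And3 jk exk sk) CL CN).
have [|a aE] := @factor_inj _ _ _ _ k (i \o f2) jk.
  by move=> x; apply/exk; rewrite /= ir (short_exact_comp0 x ex2).
have [|b bE] := @factor_inj _ _ _ _ f2 (r \o k) j2.
  by move=> x; apply/ex2; exact: (short_exact_comp0 x exk).
by exists a, b => x; apply: j2; rewrite bE /= aE /= ir.
Qed.

(** Adding the split sequence formed by complements of the two outer terms makes
    them L_p and N_p. *)
Lemma loc_retract_extension X Y Z (f : {linear X -> Y}) (g : {linear Y -> Z}) :
  short_exact f g -> loc_retract X -> loc_retract Z -> loc_retract Y.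
Proof.
move=> se [L CL XL] [N CN ZN].
have [Z' _ isoZ] := retract_complement ZN; have [X' _ isoX] := retract_complement XL.
have [f1 [g1 se1]] := short_exact_prod_map se (short_exact_prod X' Z').
have [f2 [g2 se2]] := short_exact_iso se1 isoX isoZ.
apply: loc_retract_trans (loc_retract_loc_extension se2 CL CN).
exact: retract_fst.
Qed.

Lemma add_loc_resolving : resolving (add_loc p C).
Proof.
rewrite add_locE; have [sub _ _ _] := loc_retract_add_closed.
split=> // [|X Y|X Y Z f g _ _ se mZ]; last first.
- by split=> m; [exact: loc_retract_kernel se m mZ|exact: loc_retract_extension se m mZ].
- split=> [m|[]]; last exact: loc_retract_prod.
  by split; apply: loc_retract_trans m; [exact: retract_fst|exact: retract_snd].
- exists R^o; first by case: rC.
  exact/iso_retract/isomorphic_sym/loc_ring_isomorphic.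
Qed.

Lemma dim_le_loc n (X : lmodType R) :
  dim_le C n X -> dim_le (add_loc p C) n (loc_mod p X).
Proof.
rewrite add_locE; elim: n X => [|n IH] X /=; first exact: loc_retract_loc.
move=> [K [P [i [f [se CP dK]]]]].
exists (loc_mod p K), (loc_mod p P), (loc_map p i), (loc_map p f).
by split; [exact: loc_map_short_exact|exact: loc_retract_loc|exact: IH].
Qed.

End LocalClass.

(** * From local to global resolution dimension *)

Section LocalGlobal.
Variables (R : comPzRingType) (noeth : noetherian R).
Variables (C : class (lmodType R)) (rC : resolving C).
Implicit Types K L M N X Y : lmodType R.

(** Zorn's lemma, applied to the subsets which are empty or are proper ideals
    containing [J]; the empty set is included to bound the empty chain. *)
Lemma prime_avoids_proper (J : R -> Prop) :
  J 0 -> (forall a x y, J x -> J y -> J (a * x + y)) -> ~ J 1 ->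
  exists p : spec R, forall x, J x -> x \in p.
Proof.
move=> J0 JP J1.
pose ok (A : set R) := [/\ forall a x y, A x -> A y -> A (a * x + y), ~ A 1
  & (exists x, A x) -> forall x, J x -> A x].
have [|A [[AP A1 AJ] Amax]] := @Zorn_bigcup R ok.
  move=> F Fok tot; split.
  - move=> a x y [X FX Xx] [Y FY Yy].
    have [XY|YX] := tot _ _ FX FY.
      by exists Y => //; have [h _ _] := Fok _ FY; apply: h => //; exact: XY.
    by exists X => //; have [h _ _] := Fok _ FX; apply: h => //; exact: YX.
  - by move=> [X FX]; have [_ h _] := Fok _ FX.
  - move=> [y [X FX Xy]] x Jx; exists X => //.
    by have [_ _ h] := Fok _ FX; apply: h => //; exists y.
have Aex : exists x, A x.
  apply: contrapT => A0; apply: (Amax J) => //.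
  split=> [x Ax|JA]; first by case: A0; exists x.
  by apply: A0; exists 0; exact: JA.
have {}AJ := AJ Aex.
have A0 : A 0 by exact: AJ.
have prime x y : A (x * y) -> ~ A x -> A y.
  move=> Axy Ax; pose B : set R := fun z => exists2 c, A c & exists r, z = c + r * x.
  have B1 : B 1.
    apply: contrapT => B1; apply: (Amax B).
      split=> [z Az|BA]; last by apply/Ax/BA; exists 0 => //; exists 1; rewrite add0r mul1r.
      by exists z => //; exists 0; rewrite mul0r addr0.
    split=> // [a _ _ [c Ac [r ->]] [d Ad [t ->]]|_ z Jz].
      exists (a * c + d); first exact: AP.
      by exists (a * r + t); ring.
    by exists z; [exact: AJ|exists 0; rewrite mul0r addr0].
  have [c Ac [r e]] := B1.
  have -> : y = r * (x * y) + (y * c + 0) by rewrite -[LHS]mul1r e; ring.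
  by apply: (AP) => //; exact: AP.
pose P : {pred R} := fun x => `[< A x >].
have Psub : submod_closed (P : {pred R^o}).
  split=> [|a x y]; first exact/asboolP.
  by move=> /asboolP Ax /asboolP Ay; apply/asboolP; exact: AP.
have Pproper : 1 \notin P by apply/negP => /asboolP.
have Pprime x y : x * y \in P -> (x \in P) || (y \in P).
  move=> /asboolP Axy; case: (boolP (x \in P)) => //= /asboolP Ax.
  by apply/asboolP; exact: prime Axy Ax.
by exists (Spec Psub Pproper Pprime) => x Jx; apply/asboolP; exact: AJ.
Qed.

(** Multiplication by [r] on [K] factors through a module of [C].  For a fixed
    [K] these [r] form an ideal; if [K] is finitely generated, the primes not
    containing it are those at which [K] is locally in add C_p. *)
Definition factors (r : R) K : Prop :=
  exists (N : lmodType R) (a : {linear K -> N}) (b : {linear N -> K}),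
    C N /\ forall x, b (a x) = r *: x.

Lemma factors1 K : factors 1 K -> C K.
Proof.
move=> [N [a [b [CN ab]]]].
have /retract_complement[Z _ iso] : retract K N.
  by exists a, b => x; rewrite ab scale1r.
have [_ _ Cprod _] := rC.
by have /Cprod[] := resolving_iso rC (isomorphic_sym iso) CN.
Qed.

Lemma factors0 K : factors 0 K.
Proof.
exists R^o, \0, \0; split; first by case: rC.
by move=> x; rewrite scale0r.
Qed.

Lemma factors_comb a r t K : factors r K -> factors t K -> factors (a * r + t) K.
Proof.
move=> [N [u [v [CN uv]]]] [N' [u' [v' [CN' uv']]]].
have l : linear (fun x : K => (u x, u' x) : N * N').
  by move=> b x y /=; rewrite !linearP.
exists (N * N')%type, (mklin l), ((a \*: (v \o fst)) \+ (v' \o snd)); split.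
  by case: rC => _ _ h _; apply/h.
by move=> x /=; rewrite uv uv' scalerDl scalerA.
Qed.

(** Both maps of a factorization K -> N -> K lift to free covers.  On F the lifted
    composite differs from multiplication by [r] by a map [de] into the first
    syzygy, so on that syzygy multiplication by [r] factors through the sum of
    the first syzygy of [N] and F. *)
Lemma factors_syzygy r n K K' (i : {linear K' -> 'rV[R]_n}) (f : {linear 'rV[R]_n -> K}) :
  short_exact i f -> factors r K -> factors r K'.
Proof.
move=> [ji exi sf] [N [a [b [CN ab]]]].
have /fin_gen_cover[m [g sg]] := resolving_fin_gen rC CN.
have [N1 [k sek]] := kernel_short_exact sg; have [jk exk _] := sek.
have CG := resolving_row m rC.
have CN1 := resolving_kernel noeth rC sek CG CN.
have [al alE] := row_projective (a \o f) sg.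
have [be beE] := row_projective (b \o g) sf.
(* The defect of the lifted composite maps to zero in K. *)
have [|de deE] := @factor_inj _ _ _ _ i ((be \o al) \- (r \*: idfun)) ji.
  move=> x; apply/exi; rewrite /= linearB linearZ /= beE /= alE /= ab subrr.
  by [].
have [|al' alE'] := @factor_inj _ _ _ _ k (al \o i) jk.
  by move=> x; apply/exk; rewrite /= alE /= (short_exact_comp0 x exi) linear0.
have [|be' beE'] := @factor_inj _ _ _ _ i (be \o k) ji.
  by move=> x; apply/exi; rewrite /= beE /= (short_exact_comp0 x exk) linear0.
have l : linear (fun x : K' => (al' x, i x) : N1 * 'rV[R]_n).
  by move=> c x y /=; rewrite !linearP.
exists (N1 * 'rV[R]_n)%type, (mklin l), ((be' \o fst) \- (de \o snd)); split.
  by case: rC => _ _ h _; apply/h; split=> //; exact: resolving_row.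
move=> x; apply: ji; rewrite /= linearB /= beE' deE /= alE' /= linearZ /=.
by rewrite opprD addrA subrr sub0r scalerN opprK linearZ.
Qed.

(** The inclusion and retraction between K_p and N_p lift to [a] and [b] up to
    denominators; the composite of the lifts agrees locally with a scalar, so a
    multiple of it equals a scalar outside [p]. *)
Lemma local_factors (p : spec R) K :
  fin_gen K -> add_loc p C (loc_mod p K) -> exists s : denom p, factors (den s) K.
Proof.
move=> fgK; rewrite add_locE // => -[N CN [i [r ir]]].
have [s [a aE]] := loc_map_lift i noeth fgK.
have [t [b bE]] := loc_map_lift r noeth (resolving_fin_gen rC CN).
have [|w wE] := @loc_map_eq _ p _ _ (b \o a) (den (denomM s t) \*: idfun) fgK.
  move=> x; have -> : loc_map p (b \o a) x = loc_map p b (loc_map p a x).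
    by have [m [d ->]] := fracP x; rewrite !loc_mapE.
  rewrite aE bE linearZ /= ir; have [m [d ->]] := fracP x.
  rewrite loc_mapE -(frac_scalar (den s) m d) -(frac_scalar (den t) _ d); congr (frac _ _).
  by rewrite /= scalerA mulrC.
exists (denomM w (denomM s t)), N, a, (den w \*: b); split=> // x.
by have := wE x; rewrite /= scalerA.
Qed.

Lemma syzygy_sequence X : fin_gen X ->
  exists K : nat -> lmodType R, [/\ K 0%N = X, forall n, fin_gen (K n)
    & forall n, exists m (i : {linear K n.+1 -> 'rV[R]_m}) (f : {linear 'rV[R]_m -> K n}),
        short_exact i f].
Proof.
move=> fgX.
pose T := {K : lmodType R | fin_gen K}.
pose step (t : T) (t' : T) := exists m (i : {linear sval t' -> 'rV[R]_m})
  (f : {linear 'rV[R]_m -> sval t}), short_exact i f.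
have stepP t : exists t', step t t'.
  case: t => K fgK; have /fin_gen_cover[m [f sf]] := fgK.
  have [K' [i se]] := kernel_short_exact sf; have [ji _ _] := se.
  by exists (exist _ K' (fin_gen_sub noeth ji (fin_gen_row R m))), m, i, f.
pose next t := projT1 (cid (stepP t)).
have nextP t : step t (next t) by rewrite /next; case: cid.
pose s n := iter n next (exist _ X fgX).
exists (fun n => sval (s n)); split=> // n; first exact: (svalP (s n)).
exact: nextP.
Qed.

(** If no syzygy of [X] were in [C], the ideal of all [r] such that [factors r]
    holds for some syzygy would be proper, hence contained in a prime [p].  But a
    syzygy of [X] is locally in add C_p at [p], so the ideal meets the complement
    of [p]. *)
Lemma local_finite_dim X : fin_gen X ->
  (forall p : spec R, exists n, dim_le (add_loc p C) n (loc_mod p X)) ->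
  exists n, dim_le C n X.
Proof.
move=> fgX locX; have [K [K0 fgK seK]] := syzygy_sequence fgX.
have dimK n j : C (K (j + n)%N) -> dim_le C n (K j).
  elim: n j => [|n IH] j; first by rewrite addn0.
  rewrite addnS -addSn => /IH dK; have [m [i [f se]]] := seK j.
  by exists (K j.+1), 'rV[R]_m, i, f; split=> //; exact: resolving_row.
have locK p n j : dim_le (add_loc p C) n (loc_mod p (K j)) ->
    add_loc p C (loc_mod p (K (j + n)%N)).
  elim: n j => [|n IH] j; first by rewrite addn0.
  rewrite addnS -addSn => dK; apply: IH; have [m [i [f se]]] := seK j.
  have rL := add_loc_resolving noeth p rC.
  apply: (dim_le_kernel (@loc_noetherian R p noeth) rL (loc_map_short_exact p se) _ dK).
  apply: (sub_dim_le (@loc_noetherian R p noeth) _ rL); rewrite add_locE //.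
  by apply: loc_retract_loc; exact: resolving_row.
have factors_mono r m n : (m <= n)%N -> factors r (K m) -> factors r (K n).
  move/subnK<-; elim: (n - m)%N => [|k IH] // /IH; have [l [i [f se]]] := seK (k + m)%N.
  exact: factors_syzygy se.
pose J r := exists n, factors r (K n).
suff [n /factors1] : J 1 by exists n; rewrite -K0; exact: dimK.
apply: contrapT => J1; have [||p Jp] := prime_avoids_proper _ _ J1.
- by exists 0%N; exact: factors0.
- move=> a x y [m fm] [n fn]; exists (maxn m n); apply: factors_comb.
    by apply: factors_mono fm; exact: leq_maxl.
  by apply: factors_mono fn; exact: leq_maxr.
have [n dX] := locX p; rewrite -K0 in dX.
have [s fs] := local_factors (fgK _) (locK _ _ _ dX).
by have /negP[] := denP s; apply: Jp; exists n.
Qed.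

End LocalGlobal.

(** * Classes cut out by local dimensions *)

Section Classes.
Variable R : comPzRingType.
Implicit Types C D G : class (lmodType R).

Lemma class_ext C D : sub_class C D -> sub_class D C -> C = D.
Proof.
move=> CD DC; apply: functional_extensionality_dep => X.
by apply: propositional_extensionality; split; [exact: CD|exact: DC].
Qed.

(** Ensures that [res] is an intersection over a nonempty family. *)
Lemma fin_gen_resolving : resolving (@fin_gen R).
Proof.
split=> [|||M N L f g fgM fgN _ _] //; first by split=> // X Y; exact: fin_gen_iso.
  apply: (fin_gen_iso (isomorphic_sym _) (fin_gen_prod (fin_gen_row R 0) _)).
    apply: (@inj_surj_isomorphic _ _ _ (inr_lin _ R^o)) => [x y []//|[u x]].
    by exists x; rewrite /= (thinmx0 u).
  by exists 1%N, (fun=> 1) => x; exists (fun=> x); rewrite big_ord1 [RHS]mulr1.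
move=> X Y; split=> [fg|[]]; last exact: fin_gen_prod.
by split; [apply: (@fin_gen_surj _ _ _ fst _ fg) => x; exists (x, 0)
  |apply: (@fin_gen_surj _ _ _ snd _ fg) => y; exists (0, y)].
Qed.

Lemma res_resolving G : sub_class G (@fin_gen R) -> resolving (res G).
Proof.
move=> fgG; split.
- split=> [X h|X Y iso h D rD GD]; first by apply: h => //; exact: fin_gen_resolving.
  exact: resolving_iso rD iso (h D rD GD).
- by move=> D [].
- move=> X Y; split=> [h|[hX hY] D rD GD]; last first.
    by have [_ _ prod _] := rD; apply/prod; split; [exact: hX|exact: hY].
  by split=> D rD GD; have [_ _ prod _] := rD; case/prod: (h D rD GD).
- move=> X Y Z f g fgX fgY se hZ.
  by split=> h D rD GD; have [_ _ _ ex] := rD;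
    apply/(ex _ _ _ _ _ fgX fgY se (hZ D rD GD)); exact: h.
Qed.

Lemma sub_res G : sub_class G (res G).
Proof. by move=> X GX D _; exact. Qed.

Lemma res_min G D : resolving D -> sub_class G D -> sub_class (res G) D.
Proof. by move=> rD GD X; exact. Qed.

Variable noeth : noetherian R.

Lemma LambdaP C (f : spec R -> nat) X : resolving C ->
  Lambda C (enat_fun f) X <->
  fin_gen X /\ forall p, dim_le (add_loc p C) (f p) (loc_mod p X).
Proof.
move=> rC; split=> -[fgX h]; split=> // p;
  by apply/(resdim_le (@loc_noetherian R p noeth) _ _ (add_loc_resolving noeth p rC)); exact: h.
Qed.

(** Localization preserves exact sequences and sums, and at each prime the
    dimension bound defines a resolving class. *)
Lemma Lambda_resolving C (f : spec R -> nat) :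
  resolving C -> resolving (Lambda C (enat_fun f)).
Proof.
move=> rC; have rL p : resolving (dim_le (add_loc p C) (f p)).
  exact: (dim_le_resolving (@loc_noetherian R p noeth) _ (add_loc_resolving noeth p rC)).
have [_ fgR _ _] := fin_gen_resolving.
have LP X := LambdaP f X rC.
split=> [|||X Y Z g h fgX fgY se /LP[fgZ dZ]].
- split=> [X []//|X Y iso /LP[fgX dX]]; apply/LP.
  split=> [|p]; first exact: fin_gen_iso iso fgX.
  by apply: (resolving_iso (rL p) (loc_map_iso p iso)).
- apply/LP; split=> // p; have [_ CR _ _] := rL p.
  exact: (resolving_iso (rL p) (isomorphic_sym (loc_ring_isomorphic p)) CR).
- move=> X Y; split=> [/LP[fg d]|[/LP[fgX dX] /LP[fgY dY]]].
    have [_ _ prod _] := fin_gen_resolving; have [fgX fgY] := (prod _ _).1 fg.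
    have dXY p : dim_le (add_loc p C) (f p) (loc_mod p X * loc_mod p Y)%type.
      by apply: (resolving_iso (rL p) (loc_prod_isomorphic p X Y)).
    by split; apply/LP; split=> // p; have [_ _ h _] := rL p; case: ((h _ _).1 (dXY p)).
  apply/LP; split=> [|p]; first exact: fin_gen_prod.
  apply: (resolving_iso (rL p) (isomorphic_sym (loc_prod_isomorphic p X Y))).
  by have [_ _ h _] := rL p; apply/h.
- split=> /LP[_ d]; apply/LP; split=> // p; have sep := loc_map_short_exact p se.
    exact: (resolving_kernel (@loc_noetherian R p noeth) (rL p) sep).
  exact: (resolving_extension (rL p) sep).
Qed.

Lemma sub_Lambda C (f : spec R -> nat) :
  resolving C -> sub_class C (Lambda C (enat_fun f)).
Proof.
move=> rC X CX; apply/LambdaP => //; split=> [|p]; first exact: resolving_fin_gen CX.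
apply: (sub_dim_le (@loc_noetherian R p noeth) _ (add_loc_resolving noeth p rC)).
exact: (dim_le_loc p rC (n := 0%N)).
Qed.

Lemma Lambda_Delta C (f : spec R -> nat) :
  resolving C -> sub_class (Lambda C (enat_fun f)) (Delta C).
Proof.
move=> rC X /(LambdaP _ _ rC)[fgX d]; apply/(DeltaP noeth _ rC).
by apply: local_finite_dim => // p; exists (f p).
Qed.

Lemma Lambda_resolvings C (f : spec R -> nat) :
  resolving C -> resolvings C (Lambda C (enat_fun f)).
Proof.
by move=> rC; split; [exact: Lambda_resolving|exact: sub_Lambda|exact: Lambda_Delta].
Qed.

(** An element of [enat] is determined by its finite upper bounds. *)
Lemma enat_le_inj (x y : enat) :
  (forall n, enat_le x (Some n) <-> enat_le y (Some n)) -> x = y.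
Proof.
case: x y => [m|] [n|] h //=.
- congr Some; apply/eqP; rewrite eqn_leq; apply/andP.
  by split; [apply/(h n) => /=|apply/(h m) => /=].
- by have := (h m).1; rewrite /= leqnn => /(_ isT).
- by have := (h n).2; rewrite /= leqnn => /(_ isT).
Qed.

Lemma enat_sup_le (S : class enat) n :
  enat_le (enat_sup S) (Some n) <-> forall x, S x -> enat_le x (Some n).
Proof.
rewrite enat_least_le; split=> [[m mn h] x /h|h]; last by exists n.
by case: x => //= k km; exact: leq_trans km mn.
Qed.

Lemma Phi_le C D p n : resolving C ->
  enat_le (Phi C D p) (Some n) <->
  forall X, D X -> dim_le (add_loc p C) n (loc_mod p X).
Proof.
move=> rC; have rP X :=
  resdim_le (@loc_noetherian R p noeth) (loc_mod p X) n (add_loc_resolving noeth p rC).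
rewrite enat_sup_le; split=> [h X DX|h x [X DX ->]].
  by apply/rP/h; exists X.
exact/rP/h.
Qed.

Lemma sub_Lambda_Phi C D (f : spec R -> nat) : resolving C ->
  sub_class D (@fin_gen R) ->
  Phi C D = enat_fun f -> sub_class D (Lambda C (enat_fun f)).
Proof.
move=> rC fgD e X DX; apply/LambdaP => //; split=> [|p]; first exact: fgD.
by move: X DX; apply/Phi_le => //; rewrite e /enat_fun /=.
Qed.

End Classes.

(** * Comparing the two classes *)

Section Comparison.
Variables (R : comPzRingType) (noeth : noetherian R).
Variables (A M : class (lmodType R)).
Hypotheses (rA : resolving A) (rM : resolving M) (AM : sub_class A M).
Hypothesis cogAM : cogenerates A M.
Hypothesis thickAM : forall p : spec R, thick_in (add_loc p A) (add_loc p M).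
Implicit Types X Y : class (lmodType R).

Lemma sub_Delta_Delta : sub_class (Delta A) (Delta M).
Proof.
move=> X /(DeltaP noeth _ rA)[n dX]; apply/(DeltaP noeth _ rM).
by exists n; apply: dim_le_sub dX.
Qed.

(** Thickness at [p] applies because the localization of [Z] has finite
    dimension over add A_p. *)
Lemma local_dim_le p n Z : Delta A Z ->
  dim_le (add_loc p A) n (loc_mod p Z) <-> dim_le (add_loc p M) n (loc_mod p Z).
Proof.
move=> /(DeltaP noeth _ rA)[k dZ]; split=> [d|d].
  by apply: dim_le_sub d; case: (thickAM p).
apply: (thick_dim_le (@loc_noetherian R p noeth) (thickAM p) _ _ d).
  exact: add_loc_resolving.
exact: (dim_le_loc p rA dZ).
Qed.

Lemma Lambda_Delta_cap (f : spec R -> nat) :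
  rho A (Lambda M (enat_fun f)) = Lambda A (enat_fun f).
Proof.
apply: class_ext => Z.
  move=> [DZ /(LambdaP noeth _ _ rM)[fgZ d]]; apply/(LambdaP noeth _ _ rA).
  by split=> // p; apply/local_dim_le.
move=> LZ; have DZ := Lambda_Delta noeth rA LZ; split=> //.
have [fgZ d] := (LambdaP noeth _ _ rA).1 LZ; apply/(LambdaP noeth _ _ rM).
by split=> // p; apply/local_dim_le.
Qed.

Lemma sub_eta X : sub_class X (eta M X) /\ sub_class M (eta M X).
Proof. by split=> Z h; apply: sub_res; [left|right]. Qed.

Lemma eta_resolvings X : resolvings A X -> resolvings M (eta M X).
Proof.
move=> [rX AX XD]; have [sX sM] := sub_eta X; split=> //.
  by apply: res_resolving => Z [/(resolving_fin_gen rX)|/(resolving_fin_gen rM)].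
apply: res_min; first exact: (Delta_resolving noeth rM).
by move=> Z [/XD/sub_Delta_Delta|]; last exact: (sub_Delta noeth rM).
Qed.

Lemma rho_resolvings Y : resolvings M Y -> resolvings A (rho A Y).
Proof.
move=> [rY MY YD]; split=> [|Z AZ|Z []//]; last first.
  by split; [exact: (sub_Delta noeth rA)|exact/MY/AM].
have rD := Delta_resolving noeth rA.
have [[fgD isoD] DR prodD exD] := rD; have [[_ isoY] YR prodY exY] := rY.
split.
- split=> [Z [/fgD]//|Z T iso [DZ YZ]].
  by split; [exact: isoD iso DZ|exact: isoY iso YZ].
- by [].
- move=> Z T; split=> [[/prodD[DZ DT] /prodY[YZ YT]]//|[[DZ YZ] [DT YT]]].
  by split; [apply/prodD|apply/prodY].
- move=> Z T U f g fgZ fgT se [DU YU].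
  have eD := exD _ _ _ f g fgZ fgT se DU; have eY := exY _ _ _ f g fgZ fgT se YU.
  by split=> -[/eD D /eY Y'].
Qed.

(** Let 0 -> Z -> N -> T -> 0 be an approximation of [Z] in [Y].  As an extension
    of modules of [Y], [N] is in [Y], so [N] is in [rho A Y]; and [Z] is the
    kernel of a map from [N] onto a module of [M]. *)
Lemma eta_rho Y : resolvings M Y -> eta M (rho A Y) = Y.
Proof.
move=> [rY MY YD]; apply: class_ext.
  by apply: res_min => // Z [[]|/MY].
move=> Z YZ; have /(DeltaP noeth _ rM)[n dZ] := YD _ YZ.
have [N [T [f [g [se dN MT]]]]] := cogenerated_approximation noeth rA rM cogAM dZ.
have [sr sM] := sub_eta (rho A Y).
have rE : resolving (eta M (rho A Y)).
  apply: res_resolving => U [[_ YU]|MU]; first exact: resolving_fin_gen rY YU.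
  exact: resolving_fin_gen rM MU.
apply: (resolving_kernel noeth rE se); last exact: sM.
apply: sr; split; first by apply/(DeltaP noeth _ rA); exists n.
exact: (resolving_extension rY se YZ (MY _ MT)).
Qed.

(** [Lambda M f] is resolving and contains the generators of [eta M X]: those in
    [X] because [X] is contained in [Lambda A f], hence in [Lambda M f]. *)
Lemma eta_sub_Lambda X (f : spec R -> nat) :
  resolvings A X -> Phi A X = enat_fun f -> sub_class (eta M X) (Lambda M (enat_fun f)).
Proof.
move=> RX e; have [rX _ XD] := RX; apply: res_min.
  exact: (Lambda_resolving noeth f rM).
move=> Z [XZ|]; last exact: (sub_Lambda noeth f rM).
have fgX W : X W -> fin_gen W by exact: resolving_fin_gen.
by have := sub_Lambda_Phi noeth rA fgX e XZ; rewrite -Lambda_Delta_cap => -[].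
Qed.

(** On [X] the two local dimensions agree, and [eta_sub_Lambda] bounds the
    dimensions on the rest of [eta M X] by [f]. *)
Lemma Phi_eta X (f : spec R -> nat) :
  resolvings A X -> Phi A X = enat_fun f -> Phi M (eta M X) = Phi A X.
Proof.
move=> RX e; have [_ _ XD] := RX; apply: functional_extensionality_dep => p.
apply: enat_le_inj => n; rewrite !Phi_le //; split=> d Z.
  by move=> XZ; apply/local_dim_le; [exact: XD|apply: d; apply: (sub_eta X).1].
move=> EZ; have /Phi_le -/(_ noeth rA) fn := d.
have /(LambdaP noeth _ _ rM)[_ /(_ p)] := eta_sub_Lambda RX e EZ.
apply: dim_le_mono; [exact: loc_noetherian|exact: add_loc_resolving|].
by move: fn; rewrite e.
Qed.

End Comparison.

Theorem mainTheorem1 (R : comPzRingType) (A M : class (lmodType R))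
    (Psi : class (spec R -> nat)) :
  noetherian R ->
  resolving A -> resolving M -> sub_class A M ->
  cogenerates A M ->
  (forall p : spec R, thick_in (add_loc p A) (add_loc p M)) ->
  (forall f, Psi f -> increasing f) ->
  inverse_bijections (resolvings A) (enat_funs Psi) (Phi A) (Lambda A) ->
  [/\ forall X, resolvings A X -> Phi M (eta M X) = Phi A X,
      inverse_bijections (resolvings M) (enat_funs Psi) (Phi M) (Lambda M)
    & inverse_bijections (resolvings A) (resolvings M) (eta M) (rho A)].
Proof.
move=> noeth rA rM AM cog thick _ [PhiA LambdaA LambdaPhi PhiLambda].
have RE := eta_resolvings noeth rA rM AM.
have RR := rho_resolvings noeth rA AM.
have ER := eta_rho noeth rA rM cog.
have PE X : resolvings A X -> Phi M (eta M X) = Phi A X.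
  by move=> RX; have [f _ e] := PhiA _ RX; exact: (Phi_eta noeth rA rM thick RX e).
have RhoE X : resolvings A X -> rho A (eta M X) = X.
  move=> RX; have [f _ e] := PhiA _ RX; have [_ _ XD] := RX.
  apply: class_ext => Z; last by move=> XZ; split; [exact: XD|exact: (sub_eta M X).1].
  rewrite -[in X in _ -> X](LambdaPhi _ RX) e -(Lambda_Delta_cap noeth rA rM thick) => -[DZ EZ].
  by split=> //; exact: (eta_sub_Lambda noeth rA rM thick RX e EZ).
have PM Y : resolvings M Y -> Phi M Y = Phi A (rho A Y).
  by move=> RY; rewrite -{1}(ER _ RY) PE //; exact: RR.
have LM f : Psi f -> Lambda M (enat_fun f) = eta M (Lambda A (enat_fun f)).
  move=> Pf; rewrite -(Lambda_Delta_cap noeth rA rM thick) ER //.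
  exact: (Lambda_resolvings noeth f rM).
split=> //; split=> //.
- by move=> Y RY; rewrite PM //; exact/PhiA/RR.
- by move=> _ [f _ ->]; exact: (Lambda_resolvings noeth f rM).
- move=> Y RY; have [f Pf e] := PhiA _ (RR _ RY).
  by rewrite PM // e LM // -e LambdaPhi ?ER //; exact: RR.
- move=> _ [f Pf ->]; rewrite LM // PE ?PhiLambda //; first by exists f.
  by apply: LambdaA; exists f.
Qed.
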